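(* For every $n$ there is a constant $C_n$, depending only on $n$, such that the following holds. Let $k$ be a finite field with $\operatorname{char} k\neq 2$. Let $f_1,f_2\in k[x_0,\dots,x_n]$ be homogeneous polynomials of degree $2$ that are irreducible in $k[x_0,\dots,x_n]$ and non-associate (not constant multiples of each other). Define \[\sigma=\max\left(\dim V(f_1)_{\mathrm{sing}},\ \dim V(f_2)_{\mathrm{sing}},\ \dim V(f_1,f_2)_{\mathrm{sing}}\right).\] Let $\mathbb{F}_q\supset k$ be a finite field, and let $S\subset\{1,2\}$. Then the number $N_S(f_1,f_2)$ of $\underline{x}\in\mathbb{P}^n(\mathbb{F}_q)$ such that $f_i(\underline{x})$ is a nonzero square in $\mathbb{F}_q$ for $i\in S$ and a non-square in $\mathbb{F}_q$ for $i\notin S$ satisfies \[N_S(f_1,f_2)=\frac{q^n-q^{n-1}}{4}+O\left(q^{(n+\sigma+1)/2}\right),\] that is, $\left|N_S(f_1,f_2)-\frac{q^n-q^{n-1}}{4}\right|\leq C_n\, q^{(n+\sigma+1)/2}$.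
   Context: For homogeneous polynomials $g_1,\dots,g_r$, $V(g_1,\dots,g_r)=\bigcap_i\{g_i=0\}$ denotes the vanishing locus in projective space. Here $V(f_1)$, $V(f_2)$ have pure dimension $n-1$ and $V(f_1,f_2)$ has pure dimension $n-2$ in $\mathbb{P}^n$, and the singular locus is understood scheme-theoretically via the Jacobian criterion: for $r$ equations, $V(g_1,\dots,g_r)_{\mathrm{sing}}$ is the set of points $\underline{x}\in V(g_1,\dots,g_r)$ (over an algebraic closure $\overline{k}$) at which the Jacobian matrix $\left(\partial g_i/\partial x_j\right)(\underline{x})$ has rank less than $r$. Convention: $\dim\emptyset=-1$. For $f$ homogeneous of degree $2$ and $\underline{x}\in\mathbb{P}^n(\mathbb{F}_q)$, whether $f(\underline{x})$ is a nonzero square (respectively, a non-square) in $\mathbb{F}_q$ does not depend on the choice of homogeneous coordinates in $\mathbb{F}_q$, since rescaling multiplies the value by a nonzero square. A non-square is an element of $\mathbb{F}_q$ that is not a square (in particular nonzero). *)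

(* Defs.v *)
From mathcomp Require Export all_boot all_order all_algebra.
From mathcomp Require Export classical_sets reals.
From mathcomp Require Export mpoly.

Set Implicit Arguments.
Unset Strict Implicit.
Unset Printing Implicit Defensive.

Import Order.TTheory GRing.Theory Num.Theory.
Local Open Scope classical_set_scope.
Local Open Scope ring_scope.

Definition irreducible_mpoly (k : fieldType) (m : nat) (p : {mpoly k[m]}) : Prop :=
  [/\ p != 0, p \isn't a GRing.unit &
      forall g h : {mpoly k[m]},
        p = g * h -> g \is a GRing.unit \/ h \is a GRing.unit].

Definition is_algebraic_closure (k : fieldType) (K : closedFieldType)
    (iota : {rmorphism k -> K}) : Prop :=
  integralRange iota.

(** Over an infinite field, a subset of P^n is represented by the set of all
    nonzero vectors of homogeneous coordinates of its points: a scale-invariant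
    set of nonzero row vectors. *)
Section ProjectiveSets.
Variables (K : fieldType) (n : nat).
Implicit Types (A B : set 'rV[K]_n.+1).

Definition homogeneous_mpoly (p : {mpoly K[n.+1]}) : Prop :=
  exists d : nat, p \is d.-homog.

Definition zero_locus (G : set {mpoly K[n.+1]}) : set 'rV[K]_n.+1 :=
  [set x : 'rV[K]_n.+1 | x != 0 /\ forall p, G p -> p.@[x ord0] = 0].

Definition proj_closed A : Prop :=
  exists2 G : set {mpoly K[n.+1]},
    (forall p, G p -> homogeneous_mpoly p) & A = zero_locus G.

Definition proj_irreducible A : Prop :=
  [/\ proj_closed A, A !=set0 &
      forall B C, proj_closed B -> proj_closed C ->
        A = B `|` C -> A = B \/ A = C].

(** A strictly increasing chain Z 0, ..., Z (m - 1) of m irreducible closed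
    subsets of A; the values Z i for m <= i are irrelevant. *)
Definition irreducible_chain A (m : nat) (Z : nat -> set 'rV[K]_n.+1) : Prop :=
  (forall i, (i < m)%N -> proj_irreducible (Z i) /\ Z i `<=` A) /\
  (forall i, (i.+1 < m)%N -> Z i `<` Z i.+1).

(** Krull dimension of a closed set A: the largest length of a chain of
    irreducible closed subsets, a chain of m members having length m - 1.
    The chain with no member (m = 0) gives the value -1 to the empty set. *)
Definition is_proj_dim A (d : int) : Prop :=
  (exists (m : nat) (Z : nat -> set 'rV[K]_n.+1),
      irreducible_chain A m Z /\ d = m%:Z - 1) /\
  (forall (m : nat) (Z : nat -> set 'rV[K]_n.+1),
      irreducible_chain A m Z -> m%:Z - 1 <= d).

Lemma is_proj_dim_unique A d1 d2 : is_proj_dim A d1 -> is_proj_dim A d2 -> d1 = d2.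
Proof.
move=> [[m1 [Z1 [c1 e1]]] u1] [[m2 [Z2 [c2 e2]]] u2].
apply/eqP; rewrite eq_le; apply/andP; split.
  by rewrite e1; exact: (u2 _ _ c1).
by rewrite e2; exact: (u1 _ _ c2).
Qed.

Lemma is_proj_dim_set0 : is_proj_dim set0 (-1).
Proof.
split; first by exists 0%N, (fun=> set0); split=> //; split.
move=> [|m] Z [irrZ _] //.
by have [[_ [x Z0x] _] /(_ x Z0x)] := irrZ 0%N isT.
Qed.

Definition jacobian (r : nat) (g : r.-tuple {mpoly K[n.+1]}) (x : 'rV[K]_n.+1) :
    'M[K]_(r, n.+1) :=
  \matrix_(i < r, j < n.+1) ((tnth g i)^`M(j)).@[x ord0].

Definition sing_locus (r : nat) (g : r.-tuple {mpoly K[n.+1]}) : set 'rV[K]_n.+1 :=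
  [set x : 'rV[K]_n.+1 | zero_locus [set` g] x /\ (\rank (jacobian g x) < r)%N].

End ProjectiveSets.

Section PointCount.
Variables (F : finFieldType) (n : nat).

(** A point of P^n(F) is the set of all its homogeneous coordinate vectors. *)
Definition proj_point (x : 'rV[F]_n.+1) : {set 'rV[F]_n.+1} :=
  [set c *: x | c in [pred c : F | c != 0]]%SET.

Definition is_square (a : F) : bool := [exists b : F, a == b ^+ 2].

(** The indices 1, 2 of the two polynomials are encoded as the elements 0, 1
    of 'I_2. *)
Definition square_count (f : 2.-tuple {mpoly F[n.+1]}) (S : {set 'I_2}) : nat :=
  #|[set proj_point x | x : 'rV[F]_n.+1 &
      (x != 0) &&
      [forall i : 'I_2,
         let v := (tnth f i).@[x ord0] in
         if i \in S then (v != 0) && is_square v else ~~ is_square v]]%SET|.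

End PointCount.

(* Main.v *)
Require Import Defs.
From HB Require Import structures.
From mathcomp Require Import all_boot all_order all_algebra all_field.
From mathcomp Require Import boolp classical_sets reals.
From mathcomp Require Import mpoly.
From mathcomp Require Import zify ring lra.
Set Implicit Arguments.
Unset Strict Implicit.
Unset Printing Implicit Defensive.
Import Order.TTheory GRing.Theory Num.Theory.
Local Open Scope ring_scope.

(** The count is an elementary character sum over the vectors of F_q^(n+1).
    Let chi be the quadratic character, extended by chi 0 = 0. The indicator
    of v being a nonzero square or a non-square is (1 - [v = 0] +/- chi v) / 2,
    so (q - 1) times the required number is a quarter of a combination of the
    following sums over all vectors: the numbers of zeros of f1, of f2 and of
    both, the sums of chi(f1) and chi(f2), the same sums restricted to the zeros
    of the other form, and the sum of chi(f1 f2).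

    Each of these reduces to single quadratic forms (twisted_sumE, base_countE,
    base_chisumE). The common zeros, chi(f1) on f2 = 0, and chi(f1 f2) are all
    obtained by summing over the pencil f1 - t f2: for f2(x) <> 0, the only t
    with f1(x) = t f2(x) is f1(x) / f2(x), and it has the same character as
    f1(x) f2(x). For one quadratic form of corank c everything is explicit
    (level_count_nondegenerate, excess_even and its companions), with deviations
    of size q^((n - 1 + c)/2) for the number of zeros and q^((n + c)/2) for the
    character sum, after division by q - 1.

    Coranks are controlled by the singular loci. The kernel of the matrix of
    f_i is a linear space of singular points of f_i = 0, so corank f_i <= sigma + 1.
    The vectors in the kernel of f1 - t f2 at which one of the forms vanishes are
    singular points of f1 = f2 = 0, so corank (f1 - t f2) <= sigma + 2
    (sing_locus_quadric, sing_locus_pencil). Dimensions being lengths of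
    chains of irreducible closed sets, this requires long chains inside a
    quadric (quadric_chain); the irreducibility of a quadric is seen by
    joining any two of its points by a conic. Ranks over F_q and over the
    algebraic closure are compared by means of principal minors, which are
    polynomials in t over k (rank_transfer).

    The rank drops below its generic value for boundedly many t only
    (few_rank_drops). Bounding every term of the sums over t by its size then
    suffices for all of them except that of chi(f1 f2), and fails there only when
    rank (f1 - t f2) never exceeds m = rank f2. In that case a principal minor
    D(t) of size m that is nonzero for f2 has degree exactly m; for odd m the
    generic members of the pencil contribute nothing, and for even m they
    contribute a constant times the sum of chi(t D(t)). As t D(t) has odd
    degree, this sum is O(sqrt q) (weil_bound), by Stepanov's method. Oddness
    makes the method short: the two families of terms of the auxiliary
    polynomial have degrees in disjoint sets of residues modulo q, so that its
    nonzero terms have pairwise distinct degrees and cannot cancel. *)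

(** * Hasse derivatives and multiple roots *)

Section Taylor.
Variable F : fieldType.
Implicit Types (p f h : {poly F}) (w v u : {poly {poly F}}).

Lemma dvdp_sum (I : finType) (E : I -> {poly F}) f :
  (forall i, f %| E i) -> f %| \sum_i E i.
Proof.
by move=> fE; apply: (big_ind (fun p => f %| p));
   [exact: dvdp0 | exact: dvdp_add |].
Qed.

Lemma coef_poly_XaY p k : (poly_XaY p)`_k = p^`N(k).
Proof.
have -> : poly_XaY p = \sum_(i < size p) (p^`N(i))%:P * 'X^i.
  rewrite /poly_XaY /comp_poly addrC nderiv_taylor; last exact: mulrC.
  rewrite -map_poly_comp.
  rewrite (size_map_inj_poly (f := polyC \o polyC)) //=; last first.
    by move=> a b /= /polyC_inj/polyC_inj.
  apply: eq_bigr => i _; congr (_ * _).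
  rewrite (nderivn_map (polyC \o polyC)) map_poly_comp /= horner_map /=.
  by rewrite -[(map_poly _ _).[_]]/(p^`N(i) \Po 'X) comp_polyXr.
rewrite coef_sum; case: (ltnP k (size p)) => kp.
  rewrite (bigD1 (Ordinal kp)) //= coefCM coefXn eqxx mulr1 big1 ?addr0 //.
  move=> i; rewrite -val_eqE /= => ne.
  by rewrite coefCM coefXn eq_sym (negbTE ne) mulr0.
rewrite nderivn_poly0 // big1 // => i _.
by rewrite coefCM coefXn gtn_eqF ?mulr0 // (leq_trans _ kp).
Qed.

Lemma poly_XaY_mul p h : poly_XaY (p * h) = poly_XaY p * poly_XaY h.
Proof. by rewrite /poly_XaY !rmorphM. Qed.

Lemma poly_XaY_exp p n : poly_XaY (p ^+ n) = poly_XaY p ^+ n.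
Proof. by rewrite /poly_XaY !rmorphXn. Qed.

(** In the Taylor expansion at X + Y, the k-th power of Y can absorb at most k of the
    factors f(X + Y) = f(X) + Y u, so at least b - k factors f survive. *)
Lemma nderivn_mul_pow_dvd f h b k : f ^+ (b - k) %| (h * f ^+ b)^`N(k).
Proof.
pose G b w := forall k, f ^+ (b - k) %| w`_k.
have GM b' w v : G b' w -> G b' (w * v).
  move=> Gw i; rewrite coefM; apply: dvdp_sum => l.
  have le : f ^+ (b' - i) %| f ^+ (b' - l).
    by apply: dvdp_exp2l; have := ltn_ord l; lia.
  exact: dvdp_mulr (dvdp_trans le (Gw l)).
have [u Eu] : exists u, poly_XaY f = f%:P + 'X * u.
  exists (\poly_(i < size f) (poly_XaY f)`_i.+1); apply/polyP => -[|i].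
    by rewrite coefD coefC eqxx coefXM addr0 coef_poly_XaY nderivn0.
  rewrite coefD coefC add0r coefXM /= coef_poly; case: ltnP => // le.
  by rewrite coef_poly_XaY nderivn_poly0 // ltnW.
have GS b' w : G b' w -> G b'.+1 (w * (f%:P + 'X * u)).
  move=> Gw i; rewrite mulrDr coefD mulrC coefCM; apply: dvdp_add.
    apply: (@dvdp_trans _ (f * f ^+ (b' - i))).
      by rewrite -exprS; apply: dvdp_exp2l; lia.
    exact: dvdp_mul.
  rewrite mulrCA coefXM; case: i => [|i] /=; first exact: dvdp0.
  exact: (GM b' w u Gw i).
suff : G b (poly_XaY (h * f ^+ b)) by move=> /(_ k); rewrite coef_poly_XaY.
rewrite poly_XaY_mul poly_XaY_exp Eu; elim: b => [|b IH].
  by rewrite mulr1 => i; rewrite sub0n expr0 dvd1p.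
by rewrite exprSr mulrA; apply: GS.
Qed.

(** Hasse derivatives are used because ordinary ones do not detect multiplicities
    above the characteristic. *)
Lemma dvdp_of_nderivn p x l :
  (forall k, (k < l)%N -> (p^`N(k)).[x] = 0) -> ('X - x%:P) ^+ l %| p.
Proof.
move=> H; suff -> : p = \sum_(i < size p) ((p^`N(i)).[x])%:P * ('X - x%:P) ^+ i.
  apply: dvdp_sum => i; case: (ltnP i l) => il; first by rewrite H ?mul0r ?dvdp0.
  by apply: dvdp_mull; apply: dvdp_exp2l.
rewrite -[LHS]comp_polyXr /comp_poly.
have {1}-> : 'X = x%:P + ('X - x%:P) by rewrite addrC subrK.
rewrite nderiv_taylor; last exact: mulrC.
rewrite size_map_polyC; apply: eq_bigr => i _.
by rewrite nderivn_map horner_map.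
Qed.

(** As (X + Y)^q = X^q + Y^q, powers of X^q are constants for the derivatives
    of order less than q. *)
Lemma nderivn_mul_Xq p q j k : ([pchar F]).-nat q -> (k < q)%N ->
  (p * 'X^q ^+ j)^`N(k) = p^`N(k) * 'X^q ^+ j.
Proof.
move=> qF kq; rewrite -!coef_poly_XaY poly_XaY_mul !poly_XaY_exp.
have -> : poly_XaY ('X : {poly F}) = ('X)%:P + 'X by rewrite /poly_XaY map_polyX comp_polyX addrC.
rewrite exprDn_pchar; last first.
  by apply: sub_in_pnat qF => r _; rewrite !inE => /andP[-> /eqP r0];
     rewrite -(rmorph_nat (polyC \o polyC)) /= r0 !polyC0 eqxx.
have [v ->] : exists v, (('X)%:P ^+ q + 'X ^+ q) ^+ j = ('X^q ^+ j)%:P + 'X^q * v :> {poly {poly F}}.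
  elim: j => [|j [v IH]]; first by exists 0; rewrite !expr0 mulr0 addr0.
  exists (('X^q ^+ j)%:P + v * (('X)%:P ^+ q + 'X ^+ q)).
  rewrite exprSr IH [in RHS]exprSr !rmorphM /= !rmorphXn /=; ring.
rewrite mulrDr coefD mulrC coefCM mulrCA coefXnM kq addr0; exact: mulrC.
Qed.

Lemma size_nderivn p k : (size p^`N(k) <= size p - k)%N.
Proof. exact: size_poly. Qed.

End Taylor.

Section Independence.
Variable F : fieldType.

Lemma sum_distinct_sizes (I : finType) (E : I -> {poly F}) :
  (forall i j, E i != 0 -> E j != 0 -> size (E i) = size (E j) -> i = j) ->
  \sum_i E i = 0 -> forall i, E i = 0.
Proof.
move=> inj sum0 i0; apply/eqP/negPn/negP => nz0.
have [i nzi maxi] := @arg_maxnP I i0 (fun i => E i != 0) (fun i => size (E i)) nz0.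
have /(congr1 (fun p : {poly F} => p`_(size (E i)).-1)) := sum0.
rewrite coef_sum coef0 (bigD1 i) //= big1 ?addr0 => [/eqP|j nji].
  by rewrite -lead_coefE lead_coef_eq0 (negbTE nzi).
case: (eqVneq (E j) 0) => [->|nzj]; first by rewrite coef0.
have ltji : (size (E j) < size (E i))%N.
  rewrite ltn_neqAle (maxi j nzj : (_ <= _)%N) andbT.
  by apply: contraNneq nji => /(inj _ _ nzj nzi) ->.
by rewrite nth_default // -ltnS prednK // (leq_ltn_trans _ ltji).
Qed.

Lemma exists_kernel_vector (V W : vectType F) (Phi : {linear V -> W}) :
  (dim W < dim V)%N -> exists2 v, v != 0 & Phi v = 0.
Proof.
move=> lt; pose f := linfun Phi.
have nz : (lker f != 0)%VS.
  apply: contraTneq lt => k0; rewrite -leqNgt -!dimvf.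
  by rewrite -(limg_ker_dim f fullv) k0 capv0 dimv0 add0n dimvS // subvf.
exists (vpick (lker f)); first by rewrite vpick0.
by have := memv_pick (lker f); rewrite memv_ker lfunE => /eqP.
Qed.

Lemma dvdp_prod_XsubC_exp (s : seq F) l (p : {poly F}) : uniq s ->
  (forall x, x \in s -> ('X - x%:P) ^+ l %| p) ->
  \prod_(x <- s) ('X - x%:P) ^+ l %| p.
Proof.
elim: s => [|y s IH] /=; first by rewrite big_nil dvd1p.
move=> /andP[yNs us] H; rewrite big_cons Gauss_dvdp; last first.
  rewrite coprimep_sym big_seq; apply: (big_ind (fun u => coprimep u _)).
  - exact: coprime1p.
  - by move=> u v cu cv; rewrite coprimepMl cu cv.
  - move=> x xs; apply: coprimep_expl; apply: coprimep_expr.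
    by rewrite coprimep_XsubC root_XsubC; apply: contraNneq yNs => ->.
rewrite H ?mem_head // IH // => x xs; apply: H; by rewrite inE xs orbT.
Qed.

End Independence.

(** * Stepanov's auxiliary polynomial *)

(** For K = (n - m)/2, the degree m (n - 1)/2 of f^((n-1)/2) is congruent to K
    modulo n, which is what separates the two families of terms below. *)
Lemma odd_halves n m : odd n -> odd m -> (m < n)%N ->
  (n - m = ((n - m)./2).*2 /\ m * (n.-1./2) = n * m./2 + (n - m)./2)%N.
Proof.
move=> on om ltmn; have := odd_double_half n; have := odd_double_half m.
rewrite on om; move: (n./2) (m./2) => a b Em En; move: ltmn; rewrite -En -Em => ltmn.
rewrite /= !add1n subSS -doubleB doubleK /= doubleK in ltmn *; split=> //.
rewrite -!muln2; have : (b <= a)%N by lia.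
move/subnKC => <-; rewrite addKn; move: (a - b)%N => c; ring.
Qed.

Section Stepanov.
Variables (F : finFieldType) (m l J : nat) (f : {poly F}) (a : F).
Local Notation q := #|F|.
Local Notation h := (q.-1./2).
Local Notation K := ((q - m)./2).
Local Notation W := (K + l * m + J)%N.
Hypotheses (qodd : odd q) (modd : odd m) (ltmq : (m < q)%N).
Hypotheses (szf : size f = m.+1) (lelq : (l <= q)%N).

Local Notation coeffs := 'M[F]_(J, K + K).
Implicit Types U V : coeffs.

(** The unknown U stores, row by row, the coefficients of two families of J
    polynomials of degree less than K. *)
Definition plain_part U j := rVpoly (row j (lsubmx U)).
Definition power_part U j := rVpoly (row j (rsubmx U)).
(** Stepanov's auxiliary polynomial. Where f^h takes the value a and x^q = x, it
    agrees with a polynomial of much smaller degree, and so do its derivatives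
    after multiplication by f^l. *)
Definition stepanov_poly U : {poly F} :=
  \sum_j (plain_part U j + power_part U j * f ^+ h) * 'X^q ^+ j.

Lemma size_f_exp n : size (f ^+ n) = (m * n).+1.
Proof.
have nz : f ^+ n != 0 by rewrite expf_neq0 // -size_poly_eq0 szf.
by rewrite -[LHS]prednK ?lt0n ?size_poly_eq0 // size_exp szf.
Qed.

Lemma f_exp_neq0 n : f ^+ n != 0.
Proof. by rewrite -size_poly_eq0 size_f_exp. Qed.

Lemma eq_digits b i x j y : (b * i + x = b * j + y)%N -> (x < b)%N -> (y < b)%N ->
  i = j /\ x = y.
Proof.
move=> E xb yb; have b0 : (0 < b)%N by exact: leq_ltn_trans xb.
have Ei : i = j.
  have := congr1 (divn^~ b) E.
  by rewrite ![(b * _)%N]mulnC !divnMDl // !divn_small // !addn0.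
by split=> //; move: E; rewrite Ei => /addnI.
Qed.

(** Modulo q, the degrees of the plain terms lie in [0, K) and those of the terms
    with f^h in [K, 2K); the quotients by q tell the indices j apart. Hence no two
    nonzero terms have the same degree, and nothing cancels. *)
Lemma stepanov_poly_inj U : stepanov_poly U = 0 -> U = 0.
Proof.
pose E (i : 'I_J + 'I_J) := match i with
  | inl j => plain_part U j * 'X^(q * j)
  | inr j => power_part U j * f ^+ h * 'X^(q * j) end.
move=> U0.
have sumE : \sum_i E i = 0.
  rewrite -[RHS]U0 big_sumType /= -big_split; apply: eq_bigr => j _ /=.
  by rewrite -exprM mulrDl.
have [sK mh] : (q - m = K.*2)%N /\ (m * h = q * m./2 + K)%N.
  exact: odd_halves.
have szc j : E (inl j) != 0 ->
    exists2 d, size (E (inl j)) = (q * j + d).+1 & (d < K)%N.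
  move=> /= nz; have cnz : plain_part U j != 0 by apply: contraNneq nz => ->; rewrite mul0r.
  exists (size (plain_part U j)).-1.
    by rewrite size_mulXn // -addnS prednK // lt0n size_poly_eq0.
  rewrite prednK ?lt0n ?size_poly_eq0 //; exact: size_poly.
have szs j : E (inr j) != 0 ->
    exists2 d, size (E (inr j)) = (q * (j + m./2) + (K + d)).+1 & (d < K)%N.
  move=> /= nz; have snz : power_part U j != 0.
    by apply: contraNneq nz => ->; rewrite !mul0r.
  exists (size (power_part U j)).-1.
    rewrite size_mulXn ?mulf_neq0 ?f_exp_neq0 // size_mul ?f_exp_neq0 //.
    rewrite size_f_exp mh; have : (0 < size (power_part U j))%N by rewrite lt0n size_poly_eq0.
    rewrite mulnDr; move: K (size _) (q * j)%N (q * m./2)%N => z0 z1 z2 z3.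
    by clear; lia.
  rewrite prednK ?lt0n ?size_poly_eq0 //; exact: size_poly.
have K2 : (K + K < q)%N.
  by rewrite addnn -sK; case: (m) modd ltmq => // m' _ lt; rewrite ltn_subrL (leq_trans _ lt).
clear sK mh.
have {sumE}E0 : forall i, E i = 0.
  apply: sum_distinct_sizes sumE => -[i|i] [j|j]; move: (K) (q) K2 szc szs => k0 q0 K2 szc szs.
  - move=> /szc[x -> xK] /szc[y -> yK] [] /eq_digits[||/ord_inj->] //; lia.
  - move=> /szc[x -> xK] /szs[y -> yK] [] /eq_digits[||_ Exy]; lia.
  - move=> /szs[x -> xK] /szc[y -> yK] [] /eq_digits[||_ Exy]; lia.
  - move=> /szs[x -> xK] /szs[y -> yK] [] /eq_digits[||/addIn/ord_inj->] //; lia.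
have nzX n : 'X^n != 0 :> {poly F} by rewrite -size_poly_eq0 size_polyXn.
rewrite -[U]hsubmxK.
suff [-> ->] : lsubmx U = 0 /\ rsubmx U = 0 by rewrite row_mx0.
split; apply/row_matrixP => j; rewrite row0 -[row _ _]rVpolyK.
  have /eqP := E0 (inl j); rewrite /= mulf_eq0 (negbTE (nzX _)) orbF => /eqP.
  by rewrite /plain_part => ->; rewrite linear0.
have /eqP := E0 (inr j); rewrite /= !mulf_eq0 (negbTE (nzX _)) (negbTE (f_exp_neq0 _)) !orbF.
by rewrite /power_part => /eqP->; rewrite linear0.
Qed.

(** The low-degree polynomial that takes, up to the factor f^(l-k), the values of the
    k-th Hasse derivative of f^l times the auxiliary polynomial at the points
    where f^h = a. *)
Definition reduced_derivative k U : {poly F} :=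
  \sum_(j < J) ((f ^+ l * plain_part U j)^`N(k) %/ f ^+ (l - k)
         + a *: ((f ^+ (l + h) * power_part U j)^`N(k) %/ f ^+ (l + h - k))) * 'X^j.

Lemma reduced_derivative_is_linear k : linear (reduced_derivative k).
Proof.
move=> c U V; rewrite /reduced_derivative scaler_sumr -big_split; apply: eq_bigr => j _ /=.
rewrite /plain_part /power_part !linearP /= !mulrDr -!scalerAr !linearP /=.
by rewrite !divpD !divpZl !(scalerDr, scalerA, mulrDl, scalerAl) [c * a]mulrC addrACA.
Qed.

Lemma size_reduced_derivative k U : (k <= l)%N -> (size (reduced_derivative k U) <= W)%N.
Proof.
move=> kl.
have szr n (p : {poly F}) : (l <= n)%N -> (size p <= K)%N ->
    (size (((f ^+ n * p)^`N(k) %/ f ^+ (n - k))%R) <= K + l * m)%N.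
  move=> ln sp; rewrite size_divp ?f_exp_neq0 // size_f_exp /=.
  have := size_nderivn (f ^+ n * p) k; have := size_polyMleq (f ^+ n) p.
  rewrite size_f_exp mulnBr; have : (m * k <= m * n)%N by rewrite leq_mul2l; lia.
  have : (m * k <= l * m)%N by rewrite mulnC leq_mul2r kl orbT.
  move: (size _) (size (f ^+ n * p)) (size p) K sp => z1 z2 z3 z4 sp.
  move: (m * k)%N (m * n)%N (l * m)%N => z5 z6 z7; clear -sp; lia.
apply: (leq_trans (size_sum _ _ _)); apply/bigmax_leqP => j _.
apply: (leq_trans (size_polyMleq _ _)); rewrite size_polyXn addnS /=.
apply: leq_add; last exact: ltnW.
apply: (leq_trans (size_polyD _ _)); rewrite geq_max szr ?size_poly //=.
by apply: (leq_trans (size_scale_leq _ _)); rewrite szr ?size_poly // leq_addr.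
Qed.

Lemma nderivn_stepanov_poly k U x : (k < l)%N -> f.[x] ^+ h = a ->
  ((f ^+ l * stepanov_poly U)^`N(k)).[x] = f.[x] ^+ (l - k) * (reduced_derivative k U).[x].
Proof.
move=> kl fx; have [p pp pF] := finPcharP F.
have qF : ([pchar F]).-nat q.
  apply: (@sub_in_pnat (p : nat_pred)); last first.
    by rewrite (card_pprimeChar pF) pnatX pnat_id.
  by move=> r _; rewrite inE => /eqP->.
rewrite /stepanov_poly mulr_sumr linear_sum !horner_sum mulr_sumr; apply: eq_bigr => j _.
rewrite /= mulrA nderivn_mul_Xq //; last exact: leq_trans lelq.
have -> : f ^+ l * (plain_part U j + power_part U j * f ^+ h)
       = f ^+ l * plain_part U j + f ^+ (l + h) * power_part U j.
  by rewrite exprD; ring.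
have D n (p0 : {poly F}) : f ^+ (n - k) %| (f ^+ n * p0)^`N(k).
  by rewrite mulrC nderivn_mul_pow_dvd.
rewrite nderivnD -{1}(divpK (D l _)) -{1}(divpK (D (l + h)%N _)).
rewrite (_ : l + h - k = l - k + h)%N; last by rewrite addnBAC // ltnW.
rewrite !hornerE (exprD f.[x]) fx expf_card /=; ring.
Qed.

(** The vanishing of the l reduced derivatives is a linear system with at most l W
    equations in 2 J K unknowns. A nonzero solution gives a nonzero polynomial that
    vanishes to order l at every point where f^h = a, and its degree bounds their
    number. *)
Lemma stepanov_bound : (0 < l)%N -> (l * W < 2 * J * K)%N -> a != 0 ->
  (l * #|[set x | f.[x] ^+ h == a]| <= l * m + K + m * h + q * J)%N.
Proof.
move=> l0 ltW a0.
pose Phi U : 'M[F]_(l, W) := \matrix_(k, i) (reduced_derivative k U)`_i.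
have Phi_lin : linear Phi.
  by move=> c U V; apply/matrixP => k i; rewrite !mxE reduced_derivative_is_linear coefD coefZ.
pose PhiL := GRing.isLinear.Build _ _ _ _ Phi Phi_lin.
pose PhiP : {linear coeffs -> 'M[F]_(l, W)} := HB.pack Phi PhiL.
have [|U nzU PhiU] := @exists_kernel_vector _ _ _ PhiP.
  rewrite !dim_matrix; apply: leq_trans ltW _; lia.
have red0 k : (k < l)%N -> reduced_derivative k U = 0.
  move=> kl; apply/polyP => i; rewrite coef0; case: (ltnP i W) => iW.
    by have /matrixP/(_ (Ordinal kl) (Ordinal iW)) := PhiU; rewrite !mxE.
  by rewrite nth_default // (leq_trans _ iW) // size_reduced_derivative // ltnW.
pose P := f ^+ l * stepanov_poly U.
have nzP : P != 0.
  by rewrite mulf_neq0 ?f_exp_neq0 //; apply: contraNneq nzU => /stepanov_poly_inj->.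
have : \prod_(x <- enum [set x | f.[x] ^+ h == a]) ('X - x%:P) ^+ l %| P.
  apply: dvdp_prod_XsubC_exp; first exact: enum_uniq.
  move=> x; rewrite mem_enum inE => /eqP fx; apply: dvdp_of_nderivn => k kl.
  by rewrite nderivn_stepanov_poly // red0 // horner0 mulr0.
move/dvdp_leq => /(_ nzP); rewrite prodrXl.
have -> : size ((\prod_(x <- enum [set x | f.[x] ^+ h == a]) ('X - x%:P)) ^+ l) =
    (l * #|[set x | f.[x] ^+ h == a]|).+1.
  set g := \prod_(_ <- _) _; have mg : g \is monic by exact: monic_prod_XsubC.
  rewrite -[LHS]prednK ?lt0n ?size_poly_eq0 ?monic_neq0 ?monic_exp // size_exp.
  by rewrite size_prod_XsubC -cardE mulnC.
have szaux : (size (stepanov_poly U) <= K + m * h + q * J)%N.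
  apply: (leq_trans (size_sum _ _ _)); apply/bigmax_leqP => j _.
  rewrite -exprM; apply: (leq_trans (size_polyMleq _ _)); rewrite size_polyXn addnS /=.
  apply: leq_add; last by rewrite leq_mul2l ltnW ?orbT.
  apply: (leq_trans (size_polyD _ _)); rewrite geq_max.
  rewrite (leq_trans (size_poly _ _)) ?leq_addr //=.
  apply: (leq_trans (size_polyMleq _ _)); rewrite size_f_exp addnS /= leq_add2r.
  exact: size_poly.
move=> le; have := leq_trans le (size_polyMleq _ _).
rewrite size_f_exp [(m * l)%N]mulnC; move: szaux.
move: (size (stepanov_poly U)) (l * #|_|)%N (l * m)%N (m * h)%N (q * J)%N K => z1 z2 z3 z4 z5 z6.
by clear; lia.
Qed.

End Stepanov.

(** * The quadratic character of a finite field *)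

Section QuadraticCharacter.
Variables (R : rcfType) (F : finFieldType).
Local Notation q := #|F|.
Local Notation h := (q.-1./2).
Hypothesis qodd : odd q.
Implicit Types a b : F.

Definition chi a : R := if a == 0 then 0 else if a ^+ h == 1 then 1 else -1.

Lemma card_half : q = h.*2.+1.
Proof.
have q1 := finNzRing_gt1 F; have := odd_double_half q.-1.
have -> : odd q.-1 = false by move: qodd; rewrite -{1}(prednK (ltnW q1)) /= => /negbTE.
by rewrite add0n => ->; rewrite prednK // ltnW.
Qed.

Lemma half_gt0 : (0 < h)%N.
Proof. by have := finNzRing_gt1 F; rewrite {1}card_half; case: h. Qed.

Lemma two_neq0 : 2%:R != 0 :> F.
Proof.
apply/negP => /eqP two0.
have [p pp pF] := finPcharP F.
have p2 : p = 2 by apply/eqP; move: two0 => /eqP; rewrite -(dvdn_pcharf pF) dvdn_prime2.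
have [e cF] : exists e, q = (p ^ e)%N by eexists; exact: card_pprimeChar pF.
move: qodd (finNzRing_gt1 F); rewrite cF p2 oddX orbF => /eqP->.
by rewrite expn0.
Qed.

Lemma neq_oppr a : a != 0 -> a != - a.
Proof.
move=> a0; rewrite -subr_eq0 opprK -mulr2n -mulr_natl mulf_neq0 //.
exact: two_neq0.
Qed.

Lemma expf_half a : a != 0 -> a ^+ h = 1 \/ a ^+ h = - 1.
Proof.
move=> a0; have : (a ^+ h) ^+ 2 = 1.
  apply: (mulIf a0); rewrite -exprM muln2 mul1r -exprSr -card_half; exact: expf_card.
by move/eqP; rewrite sqrf_eq1 => /orP[] /eqP; [left | right].
Qed.

Lemma chi0 : chi 0 = 0. Proof. by rewrite /chi eqxx. Qed.

Lemma chi_pm a : a != 0 -> chi a = 1 \/ chi a = -1.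
Proof. by rewrite /chi => /negbTE->; case: ifP; [left | right]. Qed.

Lemma chiM a b : chi (a * b) = chi a * chi b.
Proof.
rewrite /chi mulf_eq0; have [a0|a0] := eqVneq a 0; first by rewrite mul0r.
have [b0|b0] := eqVneq b 0; first by rewrite mulr0.
have n1 : (-1 : F) == 1 = false.
  by apply/negbTE; rewrite eq_sym neq_oppr // oner_neq0.
rewrite exprMn; have [->|->] := expf_half a0; have [->|->] := expf_half b0;
by rewrite ?mulr1 ?mul1r ?mulN1r ?opprK ?eqxx ?n1 ?mulN1r ?opprK ?mulr1 ?mul1r.
Qed.

Lemma chi_sqr a : a != 0 -> chi (a ^+ 2) = 1.
Proof.
by move=> a0; rewrite expr2 chiM; have [->|->] := chi_pm a0; rewrite ?mulrNN mulr1.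
Qed.

Lemma chi_norm a : `|chi a| <= 1.
Proof.
have [->|a0] := eqVneq a 0; first by rewrite chi0 normr0.
by have [->|->] := chi_pm a0; rewrite ?normrN normr1.
Qed.

(** If a^h = 1, then X^2 - a divides X (X^(2h) - a^h) = X^q - X, which splits. *)
Lemma half_power_is_square a : a ^+ h = 1 -> exists b, a = b ^+ 2.
Proof.
move=> ah.
have : ('X^2 - a%:P) %| ('X^q - 'X : {poly F}).
  have -> : 'X^q - 'X = 'X * (('X^2) ^+ h - a%:P ^+ h) :> {poly F}.
    by rewrite -rmorphXn /= ah polyC1 -exprM mulnC muln2 mulrBr mulr1 -exprS -card_half.
  by apply: dvdp_mull; rewrite subrXX; apply: dvdp_mulr.
rewrite finField_genPoly => /dvdp_prod_XsubC[m].
set s := mask _ _ => Es.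
have sz : size s = 2.
  by have := eqp_size Es; rewrite size_XnsubC // size_prod_XsubC => -[<-].
case Ds : s sz => [|b s'] // _; exists b.
have : root ('X^2 - a%:P) b by rewrite (eqp_root Es) root_prod_XsubC Ds mem_head.
by rewrite rootE !hornerE subr_eq0 => /eqP.
Qed.

Lemma card_sqrt a : #|[set y : F | y ^+ 2 == a]|%:R = 1 + chi a.
Proof.
have [->|a0] := eqVneq a 0.
  rewrite chi0 addr0 (_ : [set y | _] = [set 0])%SET ?cards1 //.
  by apply/setP => y; rewrite !inE expf_eq0.
case: (boolP (a ^+ h == 1)) => [ah|ah].
  have [b ab] := half_power_is_square (eqP ah).
  have b0 : b != 0 by apply: contraNneq a0 => b0; rewrite ab b0 expr0n.
  rewrite /chi (negbTE a0) ah (_ : [set y | _] = [set b; - b])%SET.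
    by rewrite cards2 neq_oppr.
  by apply/setP => y; rewrite !inE ab eqf_sqr.
rewrite /chi (negbTE a0) (negbTE ah) subrr (_ : [set y | _] = finset.set0) ?cards0 //.
apply/setP => y; rewrite !inE; apply: contraNF ah => /eqP ay.
have y0 : y != 0 by apply: contraNneq a0 => y0; rewrite -ay y0 expr0n.
rewrite -ay -exprM; apply/eqP; apply: (mulIf y0).
by rewrite mul1r -exprSr mulnC muln2 -card_half expf_card.
Qed.

Lemma sum_by_value (T : finType) (E : T -> F) (G : F -> R) :
  \sum_x G (E x) = \sum_a #|[set x | E x == a]|%:R * G a.
Proof.
rewrite (partition_big E predT) //=; apply: eq_bigr => a _.
rewrite -sum1_card natr_sum mulr_suml; apply: eq_big => [x|x /eqP->].
  by rewrite inE.
by rewrite mul1r.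
Qed.

Lemma sum_chi : \sum_a chi a = 0.
Proof.
have := @sum_by_value F (fun y => y ^+ 2) (fun=> 1).
rewrite sumr_const /= (eq_bigr (fun a => 1 + chi a)); last first.
  by move=> a _; rewrite mulr1 card_sqrt.
by rewrite big_split sumr_const /= => /eqP; rewrite -subr_eq0 opprD addrA subrr sub0r oppr_eq0 => /eqP.
Qed.

End QuadraticCharacter.

(** * Square-root cancellation for polynomials of odd degree *)

(** The order of vanishing l is the integer part of sqrt q, and J exceeds l / 2 by about
    2 m, which is enough for the unknowns to outnumber the equations. *)
Lemma stepanov_parameters (q m : nat) : odd m -> (64 * m <= q)%N -> odd q ->
  exists l J, [/\ (0 < l <= q)%N, (l * l <= q)%N,
    (l * ((q - m)./2 + l * m + J) < 2 * J * (q - m)./2)%N &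
    forall s, (l * s <= l * m + (q - m)./2 + m * q.-1./2 + q * J ->
       2 * s <= q + 13 * (m * l))%N].
Proof.
move=> om qm oq.
have m0 : (0 < m)%N by case: (m) om.
have [l ll lu] : exists2 l, (l * l <= q)%N & (q < l.+1 * l.+1)%N.
  elim: (q) => [|n [l ll lu]]; first by exists 0%N.
  case: (ltnP n.+1 (l.+1 * l.+1)) => H; first by exists l => //; rewrite ltnW.
  exists l.+1 => //; nia.
have l8 : (8 <= l)%N by rewrite leqNgt; apply/negP => l7; nia.
have lq : (8 * l <= q)%N by nia.
have mq : (m < q)%N by lia.
have [EK Emh] := odd_halves oq om mq.
have [e El /andP[e1 e2]] : exists2 e, ((l./2 + 2 * m + 2) * 2 = l + e)%N & (4 * m + 3 <= e <= 4 * m + 4)%N.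
  exists (4 * m + 4 - odd l)%N; have := odd_double_half l; case: (odd l) => /=; lia.
have Eh : (2 * q.-1./2 + 1 = q)%N by have := odd_double_half q; rewrite oq; lia.
exists l, (l./2 + 2 * m + 2)%N.
move: (l./2 + _ + _)%N ((q - m)./2) (q.-1./2) EK El Emh Eh => J K h EK El _ Eh.
have b1 : (l * l * m <= q * m)%N by rewrite leq_mul2r ll orbT.
have b2 : (8 * l * e <= q * e)%N by rewrite leq_mul2r lq orbT.
have b3 : (64 * m * e <= q * e)%N by rewrite leq_mul2r qm orbT.
have b4 : ((4 * m + 3) * q <= e * q)%N by rewrite leq_mul2r e1 orbT.
have b5 : (e * q <= (4 * m + 4) * q)%N by rewrite leq_mul2r e2 orbT.
have b6 : (q <= m * q)%N by rewrite leq_pmull.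
split=> //; first by lia.
- have E1 : (2 * (l * K) = l * (q - m))%N by rewrite EK -muln2; ring.
  have E2 : (2 * (2 * J * K) = (l + e) * (q - m))%N by rewrite EK -El -muln2; ring.
  have E3 : (2 * (l * J) = l * (l + e))%N by rewrite -El; ring.
  have E4 : (l * (q - m) + l * m = l * q)%N by rewrite -mulnDr subnK // ltnW.
  have E5 : (e * (q - m) + e * m = e * q)%N by rewrite -mulnDr subnK // ltnW.
  clear EK El Eh; lia.
- move=> s Hs; rewrite leqNgt; apply/negP => lt.
  have c1 : (l * (q + 13 * (m * l)).+1 <= l * (2 * s))%N by rewrite leq_mul2l lt orbT.
  have E1 : (2 * (q * J) = q * (l + e))%N by rewrite -El; ring.
  have E2 : (2 * (m * h) + m = m * q)%N by rewrite -Eh; ring.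
  have c2 : (m * q <= m * (l * l + 2 * l))%N by rewrite leq_mul2l; lia.
  have c3 : (8 * (m * l) <= m * l * l)%N by rewrite mulnC leq_mul2l l8 orbT.
  clear El Eh; lia.
Qed.

Section Weil.
Variables (R : rcfType) (F : finFieldType).
Local Notation q := #|F|.
Local Notation h := (q.-1./2).
Hypothesis qodd : odd q.

(** Stepanov's bound is applied to f^h = 1 and to f^h = -1. The two sets and the at
    most m zeros of f fill the field, so two upper bounds near q / 2 give the
    cancellation. For q < 64 m the trivial bound q is enough. *)
Theorem weil_bound (m : nat) (f : {poly F}) : odd m -> size f = m.+1 ->
  `|\sum_x chi R f.[x]| <= (64 * m)%:R * Num.sqrt q%:R.
Proof.
move=> om szf; set s := Num.sqrt _.
have q0 : 0 <= q%:R :> R by rewrite ler0n.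
have ss : s * s = q%:R by rewrite -expr2 sqr_sqrtr.
have s0 : 0 <= s by exact: sqrtr_ge0.
have triv : `|\sum_x chi R f.[x]| <= q%:R.
  apply: (le_trans (ler_norm_sum _ _ _)); rewrite -[q]sum1_card natr_sum.
  by apply: ler_sum => x _; apply: chi_norm.
have s1 : 1 <= s by rewrite -sqrtr1 ler_sqrt // ler1n; apply: ltnW; exact: finNzRing_gt1.
case: (ltnP q (64 * m)) => [qm|mq].
  apply: (le_trans triv); rewrite -[leLHS]mulr1; apply: ler_pM => //.
  by rewrite ler_nat ltnW.
have [l [J [/andP[l0 lq] ll cond concl]]] := stepanov_parameters om mq qodd.
have mq' : (m < q)%N by apply: leq_trans mq; case: (m) om => // m' _; lia.
have bnd a : a != 0 -> (2 * #|[set x | f.[x] ^+ h == a]| <= q + 13 * (m * l))%N.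
  by move=> a0; apply: concl; apply: stepanov_bound.
have n1 : (-1 : F) != 0 by rewrite oppr_eq0 oner_eq0.
have ne1 : (-1 : F) == 1 = false by apply/negbTE; rewrite eq_sym neq_oppr ?oner_neq0.
have ne2 : (1 : F) == -1 = false by rewrite eq_sym.
have h0 := half_gt0 qodd.
have z1 : (0 : F) == 1 = false by rewrite eq_sym oner_eq0.
have z2 : (0 : F) == -1 = false by rewrite eq_sym (negbTE n1).
pose ind (P : pred F) := #|[set x | P x]|.
have indE (P : pred F) : (ind P)%:R = \sum_x (P x)%:R :> R.
  rewrite /ind -sum1_card natr_sum [LHS]big_mkcond; apply: eq_bigr => x _.
  by rewrite inE; case: (P x).
have eqchi : \sum_x chi R f.[x] =
   (ind (fun x => f.[x] ^+ h == 1))%:R - (ind (fun x => f.[x] ^+ h == -1))%:R.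
  rewrite !indE -sumrB; apply: eq_bigr => x _; rewrite /chi.
  have [->|fx0] := eqVneq f.[x] 0.
    by rewrite expr0n eqn0Ngt h0 z1 z2 ?eqxx subrr.
  by have [->|->] := expf_half qodd fx0; rewrite eqxx ?ne1 ?ne2 ?sub0r ?subr0.
have eqq : q%:R = (ind (fun x => f.[x] ^+ h == 1))%:R +
    (ind (fun x => f.[x] ^+ h == -1))%:R + (ind (fun x => f.[x] == 0))%:R :> R.
  have -> : q%:R = \sum_(x : F) 1 :> R by rewrite sumr_const.
  rewrite !indE -!big_split; apply: eq_bigr => x _ /=.
  have [->|fx0] := eqVneq f.[x] 0.
    by rewrite expr0n eqn0Ngt h0 z1 z2 ?eqxx add0r add0r.
  by have [->|->] := expf_half qodd fx0; rewrite eqxx ?ne1 ?ne2 ?add0r ?addr0.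
have z0 : (ind (fun x => f.[x] == 0%R) <= m)%N.
  rewrite -ltnS -szf /ind cardE; apply: max_poly_roots.
  - by rewrite -size_poly_eq0 szf.
  - by apply/allP => x; rewrite mem_enum inE.
  - exact: enum_uniq.
have ls : l%:R <= s.
  rewrite -(@ler_pXn2r _ 2) ?nnegrE ?ler0n // -natrX -mulnn expr2 ss ler_nat.
  exact: ll.
have := bnd 1 (oner_neq0 _); have := bnd (-1) n1.
rewrite -!/(ind _) eqchi; move: eqq z0.
move: (ind _) (ind _) (ind _) => z nn np eqq z0.
rewrite -!(ler_nat R) in z0 *; rewrite !(natrM, natrD) => bn bp.
have m1 : 1 <= m%:R :> R by rewrite ler1n; case: (m) om.
have l1 : 1 <= l%:R :> R by rewrite ler1n.
have mls : m%:R * l%:R <= m%:R * s by rewrite ler_wpM2l // ler0n.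
have ms : m%:R <= m%:R * s by rewrite ler_peMr // ler0n.
have npos : 0 <= nn%:R :> R by rewrite ler0n.
have ppos : 0 <= np%:R :> R by rewrite ler0n.
have zpos : 0 <= z%:R :> R by rewrite ler0n.
have ms0 : 0 <= m%:R * s by rewrite mulr_ge0 // ler0n.
rewrite -mulrA ler_norml; apply/andP; split; lra.
Qed.
End Weil.

(** * Quadratic forms and pivots *)

Section Forms.
Variable F : fieldType.

Definition bf r (M : 'M[F]_r) (x y : 'rV[F]_r) : F := (x *m M *m y^T) 0 0.
Notation qf M x := (bf M x x).

Lemma bfDl r (M : 'M[F]_r) x y z : bf M (x + y) z = bf M x z + bf M y z.
Proof. by rewrite /bf !mulmxDl mxE. Qed.
Lemma bfDr r (M : 'M[F]_r) x y z : bf M z (x + y) = bf M z x + bf M z y.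
Proof. by rewrite /bf linearD mulmxDr mxE. Qed.
Lemma bfZl r (M : 'M[F]_r) c x z : bf M (c *: x) z = c * bf M x z.
Proof. by rewrite /bf -!scalemxAl mxE. Qed.
Lemma bfZr r (M : 'M[F]_r) c x z : bf M x (c *: z) = c * bf M x z.
Proof. by rewrite /bf linearZ -scalemxAr mxE. Qed.
Lemma bf_sym r (M : 'M[F]_r) x y : M^T = M -> bf M x y = bf M y x.
Proof.
move=> symM; rewrite /bf -[in LHS](trmxK (x *m M *m y^T)) mxE.
by rewrite !trmx_mul trmxK symM mulmxA.
Qed.
Lemma bf_cong r s (P : 'M[F]_(r, s)) (M : 'M[F]_s) x y :
  bf (P *m M *m P^T) x y = bf M (x *m P) (y *m P).
Proof. by rewrite /bf trmx_mul !mulmxA. Qed.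
Lemma bf_delta r (M : 'M[F]_r) i j : bf M (delta_mx 0 i) (delta_mx 0 j) = M i j.
Proof. by rewrite /bf trmx_delta -rowE -colE !mxE. Qed.

(** By polarization, a form vanishing on e_i, e_j and e_i + e_j has M i j = 0. *)
Lemma anisotropic_vector r (M : 'M[F]_r) : 2%:R != 0 :> F ->
  M^T = M -> M != 0 -> exists v, qf M v != 0.
Proof.
move=> two0 symM nz; case: (pickP (fun p : 'I_r * 'I_r => M p.1 p.2 != 0)) => [[i j] /= Mij|M0].
  case: (eqVneq (qf M (delta_mx 0 i)) 0) => [qi|]; last by exists (delta_mx 0 i).
  case: (eqVneq (qf M (delta_mx 0 j)) 0) => [qj|]; last by exists (delta_mx 0 j).
  exists (delta_mx 0 i + delta_mx 0 j).
  rewrite bfDl !bfDr qi qj [bf M (delta_mx 0 j) _]bf_sym // bf_delta.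
  by rewrite addr0 add0r -mulr2n -mulr_natl mulf_neq0.
case/eqP: nz; apply/matrixP => i j; rewrite mxE; apply/eqP.
by have := M0 (i, j) => /= /negbFE.
Qed.

(** One step of diagonalization: a vector with nonzero value is moved to the first
    place, then a Schur complement clears its row and its column. *)
Lemma split_pivot r (M : 'M[F]_(1 + r)) : 2%:R != 0 :> F ->
  M^T = M -> M != 0 ->
  exists P a (M' : 'M[F]_r), [/\ P \in unitmx, M'^T = M', a != 0 &
    P *m M *m P^T = block_mx a%:M 0 0 M'].
Proof.
move=> two0 symM nz; have [v qv] := anisotropic_vector two0 symM nz.
pose P1 := row_ebase v; pose w := row 0 P1.
have [c vc] : exists c, v = c *: w.
  exists (col_ebase v 0 0).
  have v0 : v != 0 by apply: contraNneq qv => ->; rewrite /bf !mul0mx mxE.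
  have rv : \rank v = 1%N by rewrite rank_rV v0.
  rewrite -[LHS]mulmx_ebase rv {1}[col_ebase v]mx11_scalar mul_scalar_mx -scalemxAl.
  congr (_ *: _); apply/rowP => j; rewrite !mxE (bigD1 0) //= big1 ?addr0.
    by rewrite !mxE /= mul1r.
  by move=> i; rewrite !mxE -val_eqE /= eq_sym => /negbTE->; rewrite mul0r.
pose a := qf M w.
have a0 : a != 0 by apply: contraNneq qv => aw; rewrite vc bfZl bfZr -/a aw !mulr0.
have [M1 M1E] : {M1 | M1 = P1 *m M *m P1^T} by eexists.
have symM1 : M1^T = M1 by rewrite M1E !trmx_mul trmxK symM mulmxA.
have ul : ulsubmx M1 = a%:M.
  apply/matrixP => i j; rewrite !ord1 !mxE eqxx mulr1n /a -(bf_delta M1) M1E bf_cong.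
  by rewrite -!rowE (_ : lshift r 0 = 0) //; apply: val_inj.
have dl : (ursubmx M1)^T = dlsubmx M1 by rewrite trmx_ursub symM1.
pose L : 'M[F]_(1 + r) := block_mx 1%:M 0 (- a^-1 *: dlsubmx M1) 1%:M.
exists (L *m P1), a, (drsubmx M1 - a^-1 *: dlsubmx M1 *m ursubmx M1); split=> //.
- by rewrite unitmx_mul row_ebase_unit andbT unitmxE det_lblock !det1 mulr1 unitr1.
- rewrite linearB /= trmx_mul linearZ /= dl -dl trmxK -[in RHS]scalemxAl -scalemxAr.
  by rewrite trmx_drsub symM1.
have -> : L *m P1 *m M *m (L *m P1)^T = L *m M1 *m L^T by rewrite M1E trmx_mul !mulmxA.
rewrite -[M1]submxK ul /L tr_block_mx !mulmx_block !trmx0 !trmx1.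
rewrite !(mul1mx, mulmx1, mul0mx, mulmx0, addr0, add0r).
rewrite linearZ /= -dl trmxK mul_scalar_mx -scalemxAr mul_mx_scalar !scalerA.
rewrite mulrN mulfV // !scaleN1r !addNr mul0mx scaler0 add0r.
by rewrite block_mxKdr block_mxKdl block_mxKur addrC scaleNr mulNmx.
Qed.

End Forms.
Notation qf M x := (bf M x x).

(** * Values of a nondegenerate quadratic form *)

Section CountForms.
Variables (R : rcfType) (F : finFieldType).
Local Notation q := #|F|.
Hypothesis qodd : odd q.
Local Notation chi := (@chi R F).

Definition level_count r (M : 'M[F]_r) (a : F) : R := #|[set x | qf M x == a]|%:R.
(** The function q [a = 0] - 1, by which the values of a form of even rank deviate
    from equidistribution. *)
Definition nu (a : F) : R := if a == 0 then q%:R - 1 else -1.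

Lemma level_countE r (M : 'M[F]_r) a : level_count M a = \sum_x (qf M x == a)%:R.
Proof.
rewrite /level_count -sum1_card natr_sum big_mkcond /=; apply: eq_bigr => x _.
by rewrite inE; case: (_ == _).
Qed.

Lemma level_count_cong r (P M : 'M[F]_r) a :
  P \in unitmx -> level_count (P *m M *m P^T) a = level_count M a.
Proof.
move=> uP; rewrite !level_countE [RHS](reindex (mulmx^~ P)) /=.
  by apply: eq_bigr => x _; rewrite bf_cong.
exists (mulmx^~ (invmx P)) => x _; by rewrite (mulmxK, mulmxKV).
Qed.

Lemma qf_block r c (M : 'M[F]_r) (y : 'M[F]_1) x :
  qf (block_mx c%:M 0 0 M) (row_mx y x) = c * y 0 0 ^+ 2 + qf M x.
Proof.
rewrite /bf mul_row_block !mulmx0 addr0 add0r tr_row_mx mul_row_col mxE.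
by rewrite mul_mx_scalar -scalemxAl !mxE big_ord1 !mxE expr2.
Qed.

Lemma level_count_block r c (M : 'M[F]_r) a :
  level_count (block_mx c%:M 0 0 M : 'M_(1 + r)) a = \sum_y level_count M (a - c * y ^+ 2).
Proof.
rewrite level_countE (eq_bigr (fun y => \sum_x (qf M x == a - c * y ^+ 2)%:R)); last first.
  by move=> y _; rewrite level_countE.
rewrite pair_bigA /= (reindex (fun p : F * 'rV[F]_r => row_mx (p.1%:M : 'M_1) p.2)) /=.
  apply: eq_bigr => -[y x] _ /=; rewrite qf_block mxE eqxx mulr1n.
  by rewrite [in RHS]eq_sym subr_eq addrC eq_sym.
exists (fun x : 'rV[F]_(1 + r) => (lsubmx x 0 0, rsubmx x)) => [[y x] _ /=|x _ /=].
  by rewrite row_mxKl row_mxKr mxE eqxx mulr1n.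
by rewrite -mx11_scalar hsubmxK.
Qed.

Lemma chi_mul_sqr a d : d != 0 -> chi (a * d ^+ 2) = chi a.
Proof. by move=> d0; rewrite chiM // chi_sqr // mulr1. Qed.

Lemma sum_shift (G : F -> R) c : \sum_y G (y + c) = \sum_y G y.
Proof.
symmetry; rewrite (reindex (fun y => y + c)) //=.
by exists (fun y => y - c) => y _; rewrite (addrK, subrK).
Qed.

Lemma sum_scale (G : F -> R) c : c != 0 -> \sum_y G (c * y) = \sum_y G y.
Proof.
move=> c0; symmetry; rewrite (reindex (fun y => c * y)) //=.
by exists (fun y => c^-1 * y) => y _; rewrite (mulVKf, mulKf).
Qed.

(** Each t has 1 + chi t square roots. *)
Lemma sum_sqr (G : F -> R) : \sum_y G (y ^+ 2) = \sum_t G t + \sum_t chi t * G t.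
Proof.
rewrite (sum_by_value (fun y => y ^+ 2)) -big_split; apply: eq_bigr => t _ /=.
by rewrite card_sqrt // mulrDl mul1r.
Qed.

Lemma sum_nu_sqr a d : d != 0 -> \sum_y nu (a - d * y ^+ 2) = q%:R * chi (a * d).
Proof.
move=> d0; rewrite (sum_sqr (fun t => nu (a - d * t))).
have nuE b : nu b = q%:R * (b == 0)%:R - 1.
  by rewrite /nu; case: eqP => _; rewrite (mulr1, mulr0) // sub0r.
have dl (G : F -> R) : \sum_t G t * nu (a - d * t) = q%:R * G (a / d) - \sum_t G t.
  under eq_bigr do rewrite nuE mulrBr mulr1.
  rewrite sumrB; congr (_ - _); rewrite (bigD1 (a / d)) //= big1 ?addr0.
    by rewrite [d * _]mulrCA divff // mulr1 subrr eqxx mulr1 mulrC.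
  move=> t nt; rewrite subr_eq0 (_ : a == d * t = false) ?mulr0 //.
  by apply: contraNF nt => /eqP->; rewrite mulrAC divff // mul1r.
have := dl (fun=> 1); under eq_bigr do rewrite mul1r.
move=> ->; rewrite dl sum_chi // subr0 sumr_const mulr1 subrr add0r.
by congr (_ * _); rewrite -(chi_mul_sqr (a / d) d0) expr2 mulrA divfK.
Qed.

(** For c <> 0, after sum_sqr only the sum of chi(t (t + c)) = chi(1 + c / t) over t <> 0
    remains; here 1 + c / t takes every value but 1. *)
Lemma sum_chi_sqr c : \sum_y chi (y ^+ 2 + c) = nu c.
Proof.
have [->|c0] := eqVneq c 0.
  rewrite /nu eqxx (bigD1 0) //= expr0n /= addr0 chi0 add0r.
  rewrite (eq_bigr (fun=> 1)) => [|y y0]; last by rewrite addr0 chi_sqr.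
  have := sumr_const (@predT F) (1 : R); rewrite (bigD1 0) //= => <-.
  by rewrite [1 + _]addrC addrK.
rewrite (sum_sqr (fun t => chi (t + c))) sum_shift sum_chi // add0r /nu (negbTE c0).
rewrite (bigD1 0) //= chi0 mul0r add0r.
rewrite (eq_bigr (fun t => chi (1 + c * t^-1))); last first.
  move=> t t0; rewrite -chiM // -(chi_mul_sqr (1 + _) t0) mulrDl mul1r expr2 -mulrA.
  by rewrite mulKf // mulrDr [t * c]mulrC.
have : \sum_t chi (1 + c * t^-1) = 0.
  rewrite (reindex_inj (@invr_inj F)) /=; under eq_bigr do rewrite invrK.
  rewrite (sum_scale (fun t => chi (1 + t))) //; under eq_bigr do rewrite addrC.
  by rewrite (sum_shift chi) sum_chi.
rewrite (bigD1 0) //= invr0 mulr0 addr0 -[X in chi X](expr1n _ 2) chi_sqr ?oner_neq0 //.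
by move/eqP; rewrite addrC addr_eq0 => /eqP.
Qed.

Lemma sum_chi_affine_sqr a b d : b != 0 -> d != 0 ->
  \sum_y chi (b * (a - d * y ^+ 2)) = nu a * chi (- b * d).
Proof.
move=> b0 d0; rewrite (eq_bigr (fun y => chi (- b * d) * chi (y ^+ 2 + (- (a / d))))).
  rewrite -mulr_sumr sum_chi_sqr mulrC /nu oppr_eq0 mulf_eq0 invr_eq0 (negbTE d0) orbF //.
move=> y _; rewrite -chiM //; congr chi; field; exact: d0.
Qed.

(** Induction on the number of variables: splitting off a pivot d y^2 turns the
    even-rank formula into the odd-rank one by sum_nu_sqr, and back by
    sum_chi_affine_sqr. The factor q on the left avoids the exponent k - 1. *)
Lemma level_count_nondegenerate r (M : 'M[F]_r) (a : F) : M^T = M -> \det M != 0 ->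
  (forall k, r = k.*2 -> q%:R * level_count M a =
      q%:R ^+ r + nu a * q%:R ^+ k * chi ((-1) ^+ k * \det M)) /\
  (forall k, r = k.*2.+1 -> level_count M a =
      q%:R ^+ k.*2 + q%:R ^+ k * chi ((-1) ^+ k * (a * \det M))).
Proof.
have q0 : q%:R != 0 :> R by rewrite pnatr_eq0 -lt0n ltnW // finNzRing_gt1.
elim: r M a => [|r IH] M a symM nzM.
  split=> // -[|k] // _; rewrite level_countE !expr0 det_mx00 !mulr1.
  rewrite -[X in chi X](expr1n _ 2) chi_sqr ?oner_neq0 // mulr1 /nu.
  have all0 : all_equal_to (0 : 'rV[F]_0) by move=> x; apply/rowP => -[].
  rewrite (bigD1 0) //= big1 => [|x]; last by rewrite all0 eqxx.
  rewrite addr0 /bf mul0mx mul0mx mxE eq_sym.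
  by case: eqP => _; rewrite ?mulr0 ?mulr1; ring.
have nz0 : M != 0 by apply: contraNneq nzM => ->; rewrite det0.
have [P [d [M' [uP symM' d0 E]]]] := split_pivot (two_neq0 qodd) symM nz0.
have detE : \det M * (\det P) ^+ 2 = d * \det M'.
  have := congr1 determinant E; rewrite !det_mulmx det_tr det_ublock det_scalar1 => <-.
  by ring.
have nzP : \det P != 0 by move: uP; rewrite unitmxE unitfE.
have nzM' : \det M' != 0.
  apply: contraNneq nzM => M'0; move/eqP: detE; rewrite M'0 mulr0 mulf_eq0.
  by rewrite expf_eq0 (negbTE nzP) orbF.
have chiE b : chi (b * \det M) = chi (b * (d * \det M')).
  by rewrite -detE mulrA chi_mul_sqr.
have countM : level_count M a = \sum_y level_count M' (a - d * y ^+ 2).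
  by rewrite -(level_count_cong M a uP) E level_count_block.
split=> k rk.
  case: k rk => // k [rk].
  have IH1 b : level_count M' b = q%:R ^+ k.*2 + q%:R ^+ k * chi ((-1) ^+ k * (b * \det M')).
    exact: (proj2 (IH M' b symM' nzM')).
  rewrite countM (eq_bigr _ (fun y _ => IH1 _)) big_split /= sumr_const -mulr_sumr.
  under eq_bigr do rewrite [_ * \det M']mulrC mulrA.
  rewrite sum_chi_affine_sqr ?mulf_neq0 ?signr_eq0 // chiE.
  have -> : - ((-1) ^+ k * \det M') * d = (-1) ^+ k.+1 * (d * \det M').
    by rewrite exprS; ring.
  have -> : q%:R ^+ r.+1 = q%:R ^+ k.*2.+2 :> R by rewrite rk.
  rewrite !exprS -[#|_|]/q -mulr_natl; ring.
case: rk => rk; have IH1 b := proj1 (IH M' b symM' nzM') k rk.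
apply: (mulfI q0); rewrite countM mulr_sumr.
rewrite (eq_bigr _ (fun y _ => IH1 _)) big_split /= sumr_const.
under [X in _ + X]eq_bigr do rewrite -mulrA.
rewrite -mulr_suml sum_nu_sqr // [_ * (a * _)]mulrA chiE -[q%:R ^+ r *+ _]mulr_natl.
have -> : q%:R ^+ r = q%:R ^+ k.*2 :> R by rewrite rk.
have -> : (-1) ^+ k * a * (d * \det M') = (a * d) * ((-1) ^+ k * \det M') by ring.
rewrite (chiM _ qodd (a * d)); ring.
Qed.

End CountForms.

(** * Principal minors and degenerate forms *)

Section PrincipalMinors.
Variables (F : fieldType) (N : nat).
Implicit Type M : 'M[F]_N.

Lemma mxrank_mxsub_le r (f g : 'I_r -> 'I_N) M :
  (\rank (mxsub f g M) <= \rank (rowsub f M))%N.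
Proof.
have -> : mxsub f g M = rowsub f M *m colsub g 1%:M.
  by rewrite mulmx_colsub mulmx1; apply/matrixP => i j; rewrite !mxE.
exact: mxrankM_maxl.
Qed.

Lemma minor_rank r (f g : 'I_r -> 'I_N) M :
  mxsub f g M \in unitmx -> (r <= \rank M)%N.
Proof.
move=> u; rewrite -(mxrank_unit u) (leq_trans (mxrank_mxsub_le _ _ _)) //.
exact/mxrankS/rowsub_sub.
Qed.

Lemma spanning_rows_factor r (f : 'I_r -> 'I_N) M : M^T = M ->
  (M <= rowsub f M)%MS -> exists C : 'M_(N, r), M = C *m mxsub f f M *m C^T.
Proof.
move=> symM /submxP[C MC]; exists C.
have E : colsub f M = C *m mxsub f f M.
  transitivity (colsub f (C *m rowsub f M)); first by rewrite -MC.
  by rewrite -mulmx_colsub; congr (_ *m _); apply/matrixP => i j; rewrite !mxE.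
have E2 : M = (rowsub f M)^T *m C^T by rewrite -trmx_mul -MC symM.
by rewrite -E {1}E2 trmx_mxsub symM.
Qed.

(** For a symmetric matrix, rows that span the row space also give columns that span
    the column space, hence a principal minor of maximal size. *)
Lemma exists_principal_minor M : M^T = M ->
  exists f : 'I_(\rank M) -> 'I_N, mxsub f f M \in unitmx.
Proof.
move=> symM; pose f := maxrankfun M; exists f.
have [|C MC] := @spanning_rows_factor _ f M symM; first by rewrite eq_maxrowsub.
rewrite -row_free_unit -row_leq_rank.
have := mxrankM_maxl (C *m mxsub f f M) C^T; rewrite -MC => /leq_trans; apply.
exact: mxrankM_maxr.
Qed.

(** M is the pullback, by the surjection x |-> x C, of the nondegenerate form on a
    principal minor. *)
Lemma principal_minor_factor r (f : 'I_r -> 'I_N) M :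
  M^T = M -> (\rank M <= r)%N -> mxsub f f M \in unitmx ->
  exists2 C : 'M_(N, r), M = C *m mxsub f f M *m C^T & row_full C.
Proof.
move=> symM rk u.
have le : (rowsub f M <= M)%MS by exact: rowsub_sub.
have rge : (r <= \rank (rowsub f M))%N by rewrite -{1}(mxrank_unit u) mxrank_mxsub_le.
have [|C MC] := @spanning_rows_factor _ f M symM.
  by rewrite -(geq_leqif (mxrank_leqif_sup le)) (leq_trans rk).
exists C => //; rewrite -col_leq_rank; apply: leq_trans (minor_rank u) _.
by rewrite {1}MC -mulmxA mxrankM_maxl.
Qed.

End PrincipalMinors.

Section DegenerateForms.
Variables (R : rcfType) (F : finFieldType).
Local Notation q := #|F|.
Hypothesis qodd : odd q.
Local Notation chi := (@chi R F).
Variable n : nat.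
Local Notation N := n.+1.
Implicit Type M : 'M[F]_N.
Local Notation Q := (q%:R : R).
Local Notation s := (Num.sqrt Q).

Definition chisum r (M : 'M[F]_r) : R := \sum_x chi (qf M x).
Definition excess M : R := level_count R M 0 - Q ^+ n.

Lemma card_gt1 : 1 < Q. Proof. by rewrite ltr1n finNzRing_gt1. Qed.
Lemma card_neq0 : Q != 0. Proof. by rewrite gt_eqF // (lt_trans ltr01 card_gt1). Qed.
Lemma sqrt_card_sqr : s ^+ 2 = Q. Proof. by rewrite sqr_sqrtr // ler0n. Qed.
Lemma sqrt_card_ge1 : 1 <= s.
Proof. by rewrite -[leLHS]sqrtr1; apply/ler_wsqrtr/ltW/card_gt1. Qed.

Lemma chisumE r (M : 'M[F]_r) : chisum M = \sum_a level_count R M a * chi a.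
Proof. exact: sum_by_value. Qed.

Lemma fiber_card r (C : 'M[F]_(N, r)) y : row_full C ->
  #|[set x : 'rV[F]_N | x *m C == y]|%:R * Q ^+ r = Q ^+ N.
Proof.
move=> fullC.
have fib z : #|[set x : 'rV[F]_N | x *m C == z]| = #|[set x : 'rV[F]_N | x *m C == y]|.
  pose x0 := (y - z) *m pinvmx C.
  have x0C : x0 *m C = y - z by rewrite mulmxKpV // submx_full.
  rewrite -(card_imset _ (addIr x0)); apply: eq_card => x; rewrite !inE.
  apply/imsetP/eqP => [[x' + ->]|xC].
    by rewrite inE mulmxDl x0C => /eqP->; rewrite addrC subrK.
  exists (x - x0); last by rewrite subrK.
  by rewrite inE mulmxBl xC x0C opprB addrC subrK.
have card_rV k : Q ^+ k = #|{: 'rV[F]_k}|%:R :> R by rewrite card_mx mul1n natrX.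
rewrite !card_rV -natrM; congr _%:R.
rewrite -[RHS]sum1_card (partition_big (fun x : 'rV[F]_N => x *m C) predT) //=.
rewrite mulnC -sum_nat_const; apply: eq_bigr => z _.
by rewrite -(fib z) -sum1_card; apply: eq_bigl => x; rewrite inE.
Qed.

Lemma level_count_degenerate r (f : 'I_r -> 'I_N) M a :
  M^T = M -> (\rank M <= r)%N -> mxsub f f M \in unitmx ->
  level_count R M a * Q ^+ r = Q ^+ N * level_count R (mxsub f f M) a.
Proof.
move=> symM rk u; have [C MC fullC] := principal_minor_factor symM rk u.
rewrite {1}MC !level_countE (eq_bigr (fun x => (qf (mxsub f f M) (x *m C) == a)%:R)); last first.
  by move=> x _; rewrite bf_cong.
rewrite (partition_big (fun x : 'rV[F]_N => x *m C) predT) //= mulr_suml mulr_sumr.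
apply: eq_bigr => y _.
rewrite (eq_bigr (fun=> (qf (mxsub f f M) y == a)%:R)); last by move=> x /eqP->.
rewrite sumr_const -[in RHS](fiber_card y fullC) -[(_ == _)%:R *+ _]mulr_natl mulrAC.
by congr (_%:R * _ * _); apply: eq_card => x; rewrite inE.
Qed.

Section Formulas.
Variables (r : nat) (f : 'I_r -> 'I_N) (M : 'M[F]_N).
Hypotheses (symM : M^T = M) (rk : (\rank M <= r)%N) (u : mxsub f f M \in unitmx).

Let MI := mxsub f f M.
Let symMI : MI^T = MI. Proof. by rewrite trmx_mxsub symM. Qed.
Let nzMI : \det MI != 0. Proof. by move: u; rewrite unitmxE unitfE. Qed.

Lemma excess_even k : r = k.*2 ->
  excess M * Q ^+ k = Q ^+ n * (Q - 1) * chi ((-1) ^+ k * \det MI).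
Proof.
move=> rE; have H1 := level_count_degenerate 0 symM rk u.
have H2 := proj1 (level_count_nondegenerate R qodd 0 symMI nzMI) k rE.
rewrite /nu eqxx in H2; move: H1; rewrite -/MI => H1.
have Qr : Q ^+ r = Q ^+ k * Q ^+ k by rewrite rE -addnn exprD.
apply: (mulfI (expf_neq0 k card_neq0)).
transitivity (level_count R M 0 * Q ^+ r - Q ^+ n * Q ^+ r); first by rewrite Qr /excess; ring.
transitivity (Q ^+ n * (Q * level_count R MI 0) - Q ^+ n * Q ^+ r).
  by rewrite H1 exprS; ring.
rewrite H2 Qr; ring.
Qed.

Lemma excess_odd k : r = k.*2.+1 -> excess M = 0.
Proof.
move=> rE; have H1 := level_count_degenerate 0 symM rk u.
have H2 := proj2 (level_count_nondegenerate R qodd 0 symMI nzMI) k rE.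
move: H1; rewrite -/MI H2 mul0r mulr0 chi0 mulr0 addr0 => H1.
apply/eqP; rewrite /excess subr_eq0; apply/eqP.
apply: (mulIf (expf_neq0 r card_neq0)); rewrite H1.
have -> : Q ^+ r = Q * Q ^+ k.*2 by rewrite rE exprS.
by rewrite exprS; ring.
Qed.

Lemma chisum_even k : r = k.*2 -> chisum M = 0.
Proof.
move=> rE; apply: (mulIf (expf_neq0 r.+1 card_neq0)); rewrite mul0r.
set c := chi ((-1) ^+ k * \det MI).
rewrite chisumE mulr_suml (eq_bigr (fun a => Q ^+ N * (Q ^+ r - Q ^+ k * c) * chi a)).
  by rewrite -mulr_sumr sum_chi // mulr0.
move=> a _; have [->|a0] := eqVneq a 0; first by rewrite chi0 !(mulr0, mul0r).
have H1 := level_count_degenerate a symM rk u.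
have := proj1 (level_count_nondegenerate R qodd a symMI nzMI) k rE.
rewrite /nu (negbTE a0) mulN1r mulNr -/c => <-.
transitivity (level_count R M a * Q ^+ r * (Q * chi a)); first by rewrite [Q ^+ r.+1]exprS; ring.
by rewrite H1; ring.
Qed.

Lemma chisum_odd k : r = k.*2.+1 ->
  chisum M * Q ^+ k = Q ^+ n * (Q - 1) * chi ((-1) ^+ k * \det MI).
Proof.
move=> rE; set c := chi ((-1) ^+ k * \det MI).
have Qr : Q ^+ r = Q ^+ k * Q ^+ k * Q by rewrite rE -addnn exprSr exprD.
apply: (mulIf (expf_neq0 k.+1 card_neq0)).
transitivity (chisum M * Q ^+ r); first by rewrite Qr exprSr; ring.
rewrite chisumE mulr_suml.
rewrite (eq_bigr (fun a => Q ^+ N * Q ^+ k.*2 * chi a +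
   Q ^+ N * Q ^+ k * c * (a != 0)%:R)); last first.
  move=> a _; rewrite mulrAC (level_count_degenerate a symM rk u).
  rewrite (proj2 (level_count_nondegenerate R qodd a symMI nzMI) k rE) [(-1) ^+ k * _]mulrCA (chiM _ qodd a).
  have [->|a0] /= := eqVneq a 0; first by rewrite chi0; ring.
  have cc : chi a * chi a = 1 by rewrite -chiM // -expr2 chi_sqr.
  transitivity (Q ^+ N * (chi a * Q ^+ k.*2 + Q ^+ k * c * (chi a * chi a))).
    by rewrite -/c; ring.
  by rewrite cc; ring.
rewrite big_split /= -!mulr_sumr sum_chi // mulr0 add0r.
have -> : \sum_(a : F) (a != 0)%:R = Q - 1.
  rewrite (bigD1 0) //= eqxx add0r (eq_bigr (fun=> 1)) => [|a ->//].
  have := sumr_const (@predT F) (1 : R); rewrite (bigD1 0) //= => <-.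
  by rewrite [1 + _]addrC addrK.
rewrite !exprS; ring.
Qed.

End Formulas.

Lemma card_exp_sqrt k : Q ^+ k = s ^+ k.*2.
Proof. by rewrite -[in LHS]sqrt_card_sqr -exprM mul2n. Qed.

Lemma sqrt_card_gt0 : 0 < s. Proof. exact: lt_le_trans ltr01 sqrt_card_ge1. Qed.

Lemma excess_bound M c : M^T = M -> (N <= c + \rank M)%N ->
  `|excess M| * s <= (Q - 1) * s ^+ (n + c).
Proof.
move=> symM Nc; have [f u] := exists_principal_minor symM.
have Q1 : 0 <= Q - 1 by rewrite subr_ge0 ltW // card_gt1.
have rN : (\rank M <= N)%N by exact: rank_leq_row.
have s0 := sqrt_card_gt0.
case: (boolP (odd (\rank M))) => o.
  rewrite (excess_odd symM (leqnn _) u (k := (\rank M)./2)).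
    by rewrite normr0 mul0r mulr_ge0 // exprn_ge0 // ltW.
  by rewrite -[LHS]odd_double_half o.
have rk : \rank M = (\rank M)./2.*2 by rewrite -[LHS]odd_double_half (negbTE o).
have := excess_even symM (leqnn _) u rk; move: (_./2) rk => k rk H.
have {}H : `|excess M| * s ^+ k.*2 <= s ^+ n.*2 * (Q - 1).
  rewrite -[s ^+ k.*2]ger0_norm ?exprn_ge0 ?(ltW s0) // -normrM -card_exp_sqrt H !normrM -card_exp_sqrt.
  rewrite [`|Q - 1|]ger0_norm // ger0_norm ?exprn_ge0 ?ler0n //.
  by rewrite ler_piMr ?chi_norm // mulr_ge0 // exprn_ge0 ?ler0n.
rewrite -(ler_pM2r (exprn_gt0 k.*2 s0)) mulrAC.
apply: (le_trans (ler_wpM2r (ltW s0) H)).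
rewrite mulrAC -exprSr mulrC -mulrA -exprD; apply: ler_wpM2l => //.
by apply: ler_weXn2l; [exact: sqrt_card_ge1 | lia].
Qed.

Lemma chisum_bound M c : M^T = M -> (N <= c + \rank M)%N ->
  `|chisum M| <= (Q - 1) * s ^+ (n + c).
Proof.
move=> symM Nc; have [f u] := exists_principal_minor symM.
have Q1 : 0 <= Q - 1 by rewrite subr_ge0 ltW // card_gt1.
have s0 := sqrt_card_gt0.
case: (boolP (odd (\rank M))) => o; last first.
  rewrite (chisum_even symM (leqnn _) u (k := (\rank M)./2)).
    by rewrite normr0 mulr_ge0 // exprn_ge0 // ltW.
  by rewrite -[LHS]odd_double_half (negbTE o).
have rk : \rank M = (\rank M)./2.*2.+1 by rewrite -[LHS]odd_double_half o.
have := chisum_odd symM (leqnn _) u rk; move: (_./2) rk => k rk H.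
have {}H : `|chisum M| * s ^+ k.*2 <= s ^+ n.*2 * (Q - 1).
  rewrite -[s ^+ k.*2]ger0_norm ?exprn_ge0 ?(ltW s0) // -normrM -card_exp_sqrt H !normrM -card_exp_sqrt.
  rewrite [`|Q - 1|]ger0_norm // ger0_norm ?exprn_ge0 ?ler0n //.
  by rewrite ler_piMr ?chi_norm // mulr_ge0 // exprn_ge0 ?ler0n.
rewrite -(ler_pM2r (exprn_gt0 k.*2 s0)).
apply: (le_trans H).
rewrite mulrC -mulrA -exprD; apply: ler_wpM2l => //.
by apply: ler_weXn2l; [exact: sqrt_card_ge1 | lia].
Qed.

End DegenerateForms.

(** * Pencils of quadratic forms *)

Section PencilMinors.
Variables (F : fieldType) (N : nat).
Implicit Types A B : 'M[F]_N.

Definition pencil_minor r (f : 'I_r -> 'I_N) A B : {poly F} :=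
  \det (map_mx polyC (mxsub f f A) - 'X *: map_mx polyC (mxsub f f B)).

Lemma horner_pencil_minor r (f : 'I_r -> 'I_N) A B t :
  (pencil_minor f A B).[t] = \det (mxsub f f (A - t *: B)).
Proof.
rewrite -horner_evalE -det_map_mx; congr (\det _); apply/matrixP => i j.
by rewrite !mxE /= horner_evalE !hornerE.
Qed.

Lemma size_pencil_minor r (f : 'I_r -> 'I_N) A B :
  (size (pencil_minor f A B) <= r.+1)%N.
Proof.
apply: (leq_trans (size_sum _ _ _)); apply/bigmax_leqP => s _.
rewrite size_Msign.
apply: (leq_trans (size_prod_leq _ _)).
rewrite card_ord leq_subLR addnS addnn -mul2n ltnS.
have -> : (2 * r = \sum_(i < r) 2)%N by rewrite sum_nat_const card_ord mulnC.
apply: leq_sum => i _; rewrite !mxE (leq_trans (size_polyD _ _)) // geq_max.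
rewrite (leq_trans (size_polyC_leq1 _)) //= size_polyN mulrC.
by rewrite (leq_trans (size_polyMleq _ _)) // size_polyX addnS /= addn1 ltnS size_polyC_leq1.
Qed.

(** Up to a unit, the minor is the characteristic polynomial of A_f B_f^-1. *)
Lemma size_pencil_minor_unit r (f : 'I_r -> 'I_N) A B :
  mxsub f f B \in unitmx -> size (pencil_minor f A B) = r.+1.
Proof.
move=> u; set BI := mxsub f f B; pose Y := mxsub f f A *m invmx BI.
have -> : pencil_minor f A B = (-1) ^+ r * (\det BI *: char_poly Y).
  rewrite /pencil_minor -/BI (_ : mxsub f f A = Y *m BI); last by rewrite mulmxKV.
  rewrite map_mxM /= -mul_scalar_mx -mulmxBl det_mulmx det_map_mx /= mulrC.
  by rewrite -opprB -scaleN1r detZ mulrCA mul_polyC.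
rewrite size_Msign size_scale ?size_char_poly //.
by move: u; rewrite unitmxE unitfE.
Qed.

(** A principal minor of A - t0 B of maximal size is a nonzero polynomial in t of
    degree at most N, and it vanishes wherever the rank drops below r. *)
Lemma few_rank_drops A B r t0 (s : seq F) : A^T = A -> B^T = B ->
  (r <= \rank (A - t0 *: B)%R)%N -> uniq s ->
  (forall t, t \in s -> (\rank (A - t *: B)%R < r)%N) -> (size s <= N)%N.
Proof.
move=> symA symB rk us bad.
have sym t : (A - t *: B)^T = A - t *: B by rewrite linearB linearZ /= symA symB.
have [f u] := exists_principal_minor (sym t0).
have nz : pencil_minor f A B != 0.
  apply: contraTneq u => D0; rewrite unitmxE -horner_pencil_minor D0 horner0.
  by rewrite unitr0.
rewrite -ltnS (leq_trans _ (leq_trans (size_pencil_minor f A B) _)) //; last first.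
  by rewrite ltnS rank_leq_row.
apply: max_poly_roots nz _ us; apply/allP => t ts; rewrite rootE.
apply: contraLR (bad t ts) => Dt; rewrite -leqNgt (leq_trans rk) //.
by apply: (@minor_rank _ _ _ f f); rewrite unitmxE unitfE -horner_pencil_minor.
Qed.

End PencilMinors.

Section Pencils.
Variables (R : rcfType) (F : finFieldType).
Local Notation q := #|F|.
Hypothesis qodd : odd q.
Local Notation chi := (@chi R F).
Variable n : nat.
Local Notation N := n.+1.
Local Notation Q := (q%:R : R).
Local Notation s := (Num.sqrt Q).
Implicit Types A B : 'M[F]_N.

Definition twisted_sum A B : R := \sum_x chi (qf A x) * chi (qf B x).
Definition base_count A B : R := \sum_x (qf A x == 0)%:R * (qf B x == 0)%:R.
Definition base_chisum A B : R := \sum_x chi (qf A x) * (qf B x == 0)%:R.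

Lemma bfB A B x y : bf (A - B) x y = bf A x y - bf B x y.
Proof. by rewrite /bf mulmxBr mulmxBl !mxE. Qed.
Lemma bfZ c A x y : bf (c *: A) x y = c * bf A x y.
Proof. by rewrite /bf -scalemxAr -scalemxAl mxE. Qed.

Lemma sum_indicator (b : F) (G : F -> R) : \sum_t (t == b)%:R * G t = G b.
Proof.
rewrite (bigD1 b) //= eqxx mul1r big1 ?addr0 // => t /negbTE->.
by rewrite mul0r.
Qed.

Lemma pencil_eq0 A B x t : qf B x != 0 ->
  (qf (A - t *: B) x == 0) = (t == qf A x / qf B x).
Proof.
move=> Bx; rewrite bfB bfZ subr_eq0 eq_sym.
by apply/eqP/eqP => [<-|->]; rewrite (mulfK, divfK).
Qed.

(** Where qf B x <> 0, the only t with qf A x = t qf B x has the character of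
    qf A x * qf B x; where qf B x = 0, the sum of chi over t is 0. *)
Lemma twisted_sumE A B :
  twisted_sum A B = \sum_t chi t * excess R (A - t *: B).
Proof.
have -> : \sum_t chi t * excess R (A - t *: B) = \sum_t chi t * level_count R (A - t *: B) 0.
  under eq_bigr do rewrite mulrBr.
  by rewrite sumrB -mulr_suml sum_chi // mul0r subr0.
under [RHS]eq_bigr do rewrite level_countE mulr_sumr.
rewrite exchange_big /=; apply: eq_bigr => x _.
have [Bx|Bx] := eqVneq (qf B x) 0.
  rewrite Bx chi0 mulr0; under eq_bigr do rewrite bfB bfZ Bx mulr0 subr0.
  by rewrite -mulr_suml sum_chi // mul0r.
under eq_bigr do rewrite pencil_eq0 // mulrC.
by rewrite sum_indicator -(chi_mul_sqr R qodd (qf A x / _) Bx) expr2 mulrA divfK // chiM.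
Qed.

(** A vector with qf B x <> 0 is a zero of exactly one member A - t B of the pencil,
    and a common zero of A and B is a zero of all q of them. *)
Lemma base_countE A B : Q * base_count A B =
  Q ^+ n + \sum_t excess R (A - t *: B) + excess R B.
Proof.
have sumQ (c : R) : \sum_(t : F) c = Q * c by rewrite sumr_const mulr_natl.
have -> : \sum_t excess R (A - t *: B) = \sum_t level_count R (A - t *: B) 0 - Q ^+ N.
  by rewrite sumrB sumQ exprS.
transitivity (\sum_t level_count R (A - t *: B) 0 - Q ^+ N + level_count R B 0); last first.
  by rewrite /excess; ring.
have QN : Q ^+ N = \sum_(x : 'rV[F]_N) 1 :> R.
  by rewrite sumr_const card_mx mul1n -natrX.
rewrite QN; under [X in X - _]eq_bigr do rewrite level_countE.
rewrite exchange_big /= -sumrB level_countE -big_split /= mulr_sumr; apply: eq_bigr => x _.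
have [Bx|Bx] := eqVneq (qf B x) 0.
  under eq_bigr do rewrite bfB bfZ Bx mulr0 subr0.
  by rewrite sumQ mulr1 subrK.
under eq_bigr do rewrite pencil_eq0 // -[(_ == _)%:R]mulr1.
by rewrite (sum_indicator _ (fun=> 1)) !mulr0 subrr addr0.
Qed.

(** For qf B x <> 0, the value qf A x - t qf B x runs over the whole field. *)
Lemma base_chisumE A B : Q * base_chisum A B = \sum_t chisum R (A - t *: B).
Proof.
rewrite exchange_big /= mulr_sumr; apply: eq_bigr => x _.
under eq_bigr do rewrite bfB bfZ.
have [Bx|Bx] := eqVneq (qf B x) 0.
  by under eq_bigr do rewrite Bx mulr0 subr0; rewrite sumr_const mulr1 mulr_natl.
rewrite !mulr0; under eq_bigr do rewrite addrC mulrC -mulNr.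
rewrite (sum_scale (fun y => chi (y + qf A x))) ?oppr_eq0 //.
by rewrite (sum_shift chi) sum_chi.
Qed.

Lemma norm_sum_few_exceptions (P : pred F) (G : F -> R) (a b : R) c : 0 <= a -> 0 <= b ->
  (forall s : seq F, uniq s -> all P s -> (size s <= c)%N) ->
  (forall t, ~~ P t -> `|G t| <= a) -> (forall t, P t -> `|G t| <= b) ->
  `|\sum_t G t| <= Q * a + c%:R * b.
Proof.
move=> a0 b0 few Ga Gb; apply: (le_trans (ler_norm_sum _ _ _)).
rewrite (bigID P) /= addrC; apply: lerD.
  apply: (@le_trans _ _ (\sum_(t : F) a)); last by rewrite sumr_const mulr_natl.
  rewrite big_mkcond /=; apply: ler_sum => t _; case: ifP => // /Ga //.
apply: (@le_trans _ _ (\sum_(t | P t) b)); first by apply: ler_sum => t /Gb.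
rewrite sumr_const -[leLHS]mulr_natl ler_wpM2r // ler_nat cardE few ?enum_uniq //.
by apply/allP => t; rewrite mem_enum.
Qed.

End Pencils.

(** * Error terms for a pencil *)

Section Estimates.
Variables (R : rcfType) (F : finFieldType).
Local Notation q := #|F|.
Hypothesis qodd : odd q.
Local Notation chi := (@chi R F).
Variables (n kappa : nat).
Local Notation N := n.+1.
Local Notation Q := (q%:R : R).
Local Notation s := (Num.sqrt Q).
Local Notation rho := ((Q - 1) * s ^+ (n + kappa)).

Let s1 : 1 <= s. Proof. exact: sqrt_card_ge1. Qed.
Let s0 : 0 < s. Proof. exact: sqrt_card_gt0. Qed.
Let ss : s * s = Q. Proof. by rewrite -expr2 sqrt_card_sqr. Qed.
Let Q1 : 1 < Q. Proof. exact: card_gt1. Qed.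
Let Q0 : 0 < Q. Proof. exact: lt_trans ltr01 Q1. Qed.
Let rho0 : 0 <= rho.
Proof. by rewrite mulr_ge0 ?exprn_ge0 ?(ltW s0) // subr_ge0 ltW. Qed.

Lemma excess_le (M : 'M[F]_N) : M^T = M -> (N <= kappa.+1 + \rank M)%N ->
  `|excess R M| <= rho.
Proof.
move=> symM rk; have := excess_bound R qodd symM rk.
by rewrite addnS exprSr mulrA ler_pM2r.
Qed.

Lemma excess_le_div (M : 'M[F]_N) : M^T = M -> (N.+1 <= kappa + \rank M)%N ->
  `|excess R M| <= rho / Q.
Proof.
move=> symM; case: kappa => [|k] rk.
  by have := rank_leq_row M; rewrite leqNgt rk.
have := @excess_bound R F qodd n M k symM; rewrite addSn ltnS in rk => /(_ rk).
move=> H; rewrite -(ler_pM2r s0); apply: (le_trans H).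
rewrite le_eqVlt; apply/orP; left; apply/eqP; rewrite addnS exprSr -[in X in _ / X]ss; field; exact: lt0r_neq0 s0.
Qed.

Lemma chisum_le (M : 'M[F]_N) : M^T = M -> (N <= kappa + \rank M)%N ->
  `|chisum R M| <= rho.
Proof. by move=> symM rk; have := chisum_bound R qodd symM rk. Qed.

Lemma chisum_le_mul (M : 'M[F]_N) : M^T = M -> (N <= kappa.+1 + \rank M)%N ->
  `|chisum R M| <= Q * rho.
Proof.
move=> symM rk; apply: le_trans (chisum_bound R qodd symM rk) _.
have -> : (Q - 1) * s ^+ (n + kappa.+1) = s * rho by rewrite addnS exprSr; ring.
by apply: ler_wpM2r => //; rewrite -[leRHS]ss; apply: ler_peMl => //; exact: ltW.
Qed.

Variables A B : 'M[F]_N.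
Hypotheses (symA : A^T = A) (symB : B^T = B).
Hypothesis rkB : (N <= kappa + \rank B)%N.
Hypothesis rkAB : forall t, (N <= kappa.+1 + \rank (A - t *: B)%R)%N.

Let symP t : (A - t *: B)^T = A - t *: B.
Proof. by rewrite linearB linearZ /= symA symB. Qed.

Lemma base_count_estimate : `|base_count R A B - Q ^+ n / Q| <= 2%:R * rho.
Proof.
have E := base_countE R A B.
have -> : base_count R A B - Q ^+ n / Q =
    (\sum_t excess R (A - t *: B) + excess R B) / Q.
  apply: (mulfI (lt0r_neq0 Q0)); rewrite mulrBr E -addrA addrC.
  by field; exact: lt0r_neq0 Q0.
rewrite normrM normfV (gtr0_norm Q0) ler_pdivrMr //.
apply: (le_trans (ler_normD _ _)).
have : `|\sum_t excess R (A - t *: B)| <= Q * rho.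
  apply: (le_trans (ler_norm_sum _ _ _)).
  apply: (@le_trans _ _ (\sum_(t : F) rho)); last by rewrite sumr_const mulr_natl.
  by apply: ler_sum => t _; apply: excess_le.
have : `|excess R B| <= rho by apply: excess_le => //; rewrite (leq_trans rkB) // leq_add2r.
have : rho <= Q * rho by rewrite ler_peMl // ltW.
lra.
Qed.

(** The only place where cancellation over t can be needed. *)
Lemma twisted_sum_estimate : `|twisted_sum R A B| <= (65 * n.+2)%:R * rho.
Proof.
rewrite twisted_sumE //.
pose m : nat := \rank B.
have chiE t : `|chi t * excess R (A - t *: B)| <= `|excess R (A - t *: B)|.
  by rewrite normrM ler_piMl // chi_norm.
(* If the generic rank of A - t B exceeds rank B, then the generic terms are
   smaller than rho by the factor q, and no cancellation is needed. *)
case: (boolP [exists t, (m < \rank (A - t *: B)%R)%N]) => [/existsP[t0 rk0]|/existsPn small].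
  apply: (@le_trans _ _ (Q * (rho / Q) + N%:R * rho)).
    apply: (@norm_sum_few_exceptions _ _ (fun t => (\rank (A - t *: B)%R < m.+1)%N)) => //.
    - by rewrite mulr_ge0 // invr_ge0 ltW.
    - move=> l ul /allP bad; exact: (few_rank_drops symA symB rk0 ul).
    - move=> t; rewrite -leqNgt => rk; apply: (le_trans (chiE t)).
      by apply: excess_le_div => //; have := rkB; rewrite -/m in rk *; lia.
    - by move=> t _; apply: (le_trans (chiE t)); apply: excess_le.
  rewrite mulrC divfK ?lt0r_neq0 // -{1}[rho]mul1r -mulrDl ler_wpM2r //.
  by rewrite addrC natr1 ler_nat; lia.
have {}small t : (\rank (A - t *: B)%R <= m)%N by rewrite leqNgt small.
(* Otherwise a principal minor of B of size m = rank B is a polynomial D of degree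
   exactly m, and it carries the discriminant of A - t B wherever D.[t] <> 0. *)
have [f uB] := exists_principal_minor symB; rewrite -/m in f uB.
pose D := pencil_minor f A B.
have szD : size D = m.+1 by exact: size_pencil_minor_unit.
have nzD : D != 0 by rewrite -size_poly_eq0 szD.
have mN : (m <= N)%N by exact: rank_leq_row.
rewrite (bigID (fun t => D.[t] != 0)) /=.
have few : `|\sum_(t | ~~ (D.[t] != 0)) chi t * excess R (A - t *: B)| <= N%:R * rho.
  apply: (le_trans (ler_norm_sum _ _ _)).
  apply: (@le_trans _ _ (\sum_(t | ~~ (D.[t] != 0)) rho)).
    by apply: ler_sum => t _; apply: (le_trans (chiE t)); apply: excess_le.
  rewrite sumr_const -[leLHS]mulr_natl ler_wpM2r // ler_nat.
  rewrite (leq_trans _ mN) // -ltnS -szD cardE.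
  apply: max_poly_roots => //; last exact: enum_uniq.
  by apply/allP => t; rewrite mem_enum => /negPn.
have generic : `|\sum_(t | D.[t] != 0) chi t * excess R (A - t *: B)| <= (64 * n.+2)%:R * rho.
  have uD t : D.[t] != 0 -> mxsub f f (A - t *: B) \in unitmx.
    by rewrite unitmxE unitfE -horner_pencil_minor.
  case: (boolP (odd m)) => om.
    rewrite big1 ?normr0 => [|t Dt]; first exact: mulr_ge0 (ler0n _ _) rho0.
    rewrite (excess_odd R qodd (symP t) (small t) (uD t Dt) (k := m./2)) ?mulr0 //.
    by rewrite -[LHS]odd_double_half om.
  have mk : m = m./2.*2 by rewrite -[LHS]odd_double_half (negbTE om).
  move: (m./2) mk => k mk.
  (* 'X * D has degree m + 1, which is odd. *)
  have weil := @weil_bound R F qodd m.+1 ('X * D).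
  rewrite /= om size_mul ?polyX_eq0 // size_polyX szD in weil.
  have {weil}:= weil isT erefl; set W := \sum_x _ => weil.
  have E : (\sum_(t | D.[t] != 0) chi t * excess R (A - t *: B)) * Q ^+ k =
      Q ^+ n * (Q - 1) * chi ((-1) ^+ k) * W.
    rewrite mulr_suml /W mulr_sumr big_mkcond /=; apply: eq_bigr => t _.
    rewrite !hornerE (chiM _ qodd t).
    case: ifPn => [Dt|/negPn/eqP->]; last by rewrite chi0 !mulr0.
    rewrite -mulrA (excess_even R qodd (symP t) (small t) (uD t Dt) mk).
    by rewrite -horner_pencil_minor -/D (chiM _ qodd ((-1) ^+ k)); ring.
  have Wn : `|chi ((-1) ^+ k)| * `|W| <= (64 * n.+2)%:R * s.
    apply: (@le_trans _ _ `|W|); first by rewrite ler_piMl // chi_norm.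
    apply: (le_trans weil); rewrite ler_wpM2r ?(ltW s0) // ler_nat leq_mul2l /= ltnS.
    exact: mN.
  have Q10 : 0 <= Q - 1 by rewrite subr_ge0 ltW.
  rewrite -(ler_pM2r (exprn_gt0 k Q0)) -[X in `|_| * X](gtr0_norm (exprn_gt0 k Q0)) -normrM E.
  rewrite !normrM -mulrA [`|Q - 1|]ger0_norm // ger0_norm ?exprn_ge0 ?(ltW Q0) //.
  apply: le_trans (ler_wpM2l _ Wn) _; first by rewrite mulr_ge0 // exprn_ge0 // ltW.
  have -> : Q ^+ n * (Q - 1) * ((64 * n.+2)%:R * s)
      = (Q - 1) * (64 * n.+2)%:R * s ^+ (n.*2.+1) by rewrite card_exp_sqrt exprSr; ring.
  have -> : (64 * n.+2)%:R * rho * Q ^+ k =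
      (Q - 1) * (64 * n.+2)%:R * s ^+ (n + kappa + k.*2) by rewrite card_exp_sqrt [in RHS]exprD; ring.
  apply: ler_wpM2l; first by rewrite mulr_ge0.
  by apply: ler_weXn2l => //; rewrite -addnn -addnS -addnA leq_add2l -mk.
apply: (le_trans (ler_normD _ _)); apply: (le_trans (lerD generic few)).
rewrite -mulrDl ler_wpM2r // -natrD ler_nat; lia.
Qed.

Hypothesis rkA : (N <= kappa + \rank A)%N.

(** Members of the pencil whose corank exceeds that of A cost an extra sqrt q, but at
    most N values of t give such members, and the average over t divides by q. *)
Lemma base_chisum_estimate : `|base_chisum R A B| <= n.+2%:R * rho.
Proof.
have E := base_chisumE R qodd A B.
rewrite -(ler_pM2l Q0) -{1}(gtr0_norm Q0) -normrM E.
have -> : Q * (n.+2%:R * rho) = Q * rho + N%:R * (Q * rho) by rewrite -natr1; ring.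
apply: (@norm_sum_few_exceptions _ _ (fun t => (\rank (A - t *: B)%R < \rank A)%N)) => //.
- by rewrite mulr_ge0 // ltW.
- move=> l ul /allP bad; apply: (few_rank_drops (t0 := 0) symA symB (leqnn _) ul).
  by move=> t /bad; rewrite scale0r subr0.
- move=> t; rewrite -leqNgt => rk; apply: chisum_le => //.
  by rewrite (leq_trans rkA) // leq_add2l.
- by move=> t _; apply: chisum_le_mul.
Qed.

End Estimates.

(** * From vectors to projective points *)

Section SquareCount.
Variables (R : rcfType) (F : finFieldType).
Local Notation q := #|F|.
Hypothesis qodd : odd q.
Local Notation chi := (@chi R F).
Variable n : nat.
Local Notation N := n.+1.
Local Notation Q := (q%:R : R).
Local Notation s := (Num.sqrt Q).

Lemma oppr1_eq1 : (-1 : R) == 1 = false.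
Proof. by rewrite eq_sym -subr_eq0 opprK -[1 + 1]/(2%:R) pnatr_eq0. Qed.

Lemma is_squareE (v : F) : is_square v = (v == 0) || (chi v == 1).
Proof.
rewrite /is_square; have [->|v0] := eqVneq v 0.
  by apply/existsP; exists 0; rewrite expr0n.
apply/existsP/eqP => [[b /eqP vb]|].
  by rewrite vb chi_sqr //; apply: contraNneq v0 => b0; rewrite vb b0 expr0n.
rewrite /chi (negbTE v0); case: ifPn => [/eqP vh _|_].
  by have [b ->] := half_power_is_square qodd vh; exists b.
by move/eqP; rewrite oppr1_eq1.
Qed.

(** The condition at one index of the count: b tells whether the value is to be a
    nonzero square or a non-square. *)
Definition square_class (b : bool) (v : F) : bool :=
  if b then (v != 0) && is_square v else ~~ is_square v.

Lemma square_classE b v :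
  (square_class b v)%:R = (1 - (v == 0)%:R + (-1) ^+ (~~ b) * chi v) / 2%:R :> R.
Proof.
rewrite /square_class is_squareE; have [->|v0] := eqVneq v 0.
  by case: b; rewrite /= chi0 mulr0 addr0 subrr mul0r.
by case: b; have [->|->] := chi_pm R v0; rewrite /= ?eqxx ?oppr1_eq1 /=; field.
Qed.

Lemma square_classZ b c v : c != 0 -> square_class b (c ^+ 2 * v) = square_class b v.
Proof.
move=> c0; rewrite /square_class !is_squareE mulf_eq0 expf_eq0 (negbTE c0) /=.
by rewrite mulrC chi_mul_sqr.
Qed.

Lemma square_class_neq0 b v : square_class b v -> v != 0.
Proof. by rewrite /square_class is_squareE; case: b => [/andP[]|/norP[]]. Qed.

Lemma proj_point_eq (x y : 'rV[F]_N) : x != 0 ->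
  (proj_point y == proj_point x) = (y \in proj_point x).
Proof.
move=> x0; apply/eqP/idP => [<-|/imsetP[c]].
  by apply/imsetP; exists 1; rewrite ?inE ?oner_neq0 ?scale1r.
rewrite inE => c0 ->; apply/setP => z; apply/imsetP/imsetP => -[d]; rewrite inE => d0 ->.
  by exists (d * c); rewrite ?inE ?mulf_neq0 ?scalerA.
by exists (d / c); rewrite ?inE ?mulf_neq0 ?invr_eq0 // scalerA divfK.
Qed.

Lemma card_proj_point (x : 'rV[F]_N) : x != 0 -> #|proj_point x| = q.-1.
Proof.
move=> x0; rewrite card_imset; last first.
  by move=> c d /eqP; rewrite -subr_eq0 -scalerBl scaler_eq0 (negbTE x0) orbF subr_eq0 => /eqP.
by rewrite -(cardC1 (0 : F)); apply: eq_card => c; rewrite !inE.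
Qed.

(** Projective points are the fibres, each of q - 1 vectors, of the cone over them. *)
Lemma card_cone (D : {set 'rV[F]_N}) :
  (forall x, x \in D -> x != 0) -> (forall c x, c != 0 -> x \in D -> c *: x \in D) ->
  (#|D| = #|[set proj_point x | x in D]%SET| * q.-1)%N.
Proof.
move=> D0 DZ; rewrite -sum1_card (partition_big_imset (@proj_point F n)) /=.
rewrite -sum_nat_const; apply: eq_bigr => _ /imsetP[x xD ->].
rewrite sum1_card -(card_proj_point (D0 x xD)); apply: eq_card => y.
rewrite unfold_in /= proj_point_eq ?D0 //; apply: andb_idl => /imsetP[c].
by rewrite inE => c0 ->; apply: DZ.
Qed.

Variables (kappa : nat) (A B : 'M[F]_N).
Hypotheses (symA : A^T = A) (symB : B^T = B).
Hypothesis rkA : (N <= kappa + \rank A)%N.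
Hypothesis rkB : (N <= kappa + \rank B)%N.
Hypothesis rkAB : forall t, (N <= kappa.+1 + \rank (A - t *: B)%R)%N.
Hypothesis rkBA : forall t, (N <= kappa.+1 + \rank (B - t *: A)%R)%N.

Lemma qf_scale (M : 'M[F]_N) c x : qf M (c *: x) = c ^+ 2 * qf M x.
Proof. by rewrite bfZl bfZr expr2 mulrA. Qed.

Lemma qf0 (M : 'M[F]_N) : qf M 0 = 0.
Proof. by rewrite /bf !mul0mx mxE. Qed.

Definition square_cone b1 b2 :=
  [set x : 'rV[F]_N | square_class b1 (qf A x) && square_class b2 (qf B x)].

(** The product of the two indicators of square_classE is expanded into the
    sums estimated above. *)
Lemma affine_count_estimate b1 b2 :
  `|4%:R * #|square_cone b1 b2|%:R - (Q - 1) * (Q ^+ n - Q ^+ n / Q)|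
     <= (73 * n.+2)%:R * ((Q - 1) * s ^+ (n + kappa)).
Proof.
set D := square_cone b1 b2; set e1 : R := (-1) ^+ (~~ b1); set e2 : R := (-1) ^+ (~~ b2).
have e1n : `|e1| = 1 by rewrite /e1; case: (b1); rewrite /= ?normrN normr1.
have e2n : `|e2| = 1 by rewrite /e2; case: (b2); rewrite /= ?normrN normr1.
have QN : \sum_(x : 'rV[F]_N) 1 = Q * Q ^+ n :> R.
  by rewrite -exprS sumr_const card_mx mul1n -natrX.
have DE : 4%:R * #|D|%:R =
  (\sum_(x : 'rV[F]_N) 1 - level_count R A 0 - level_count R B 0 + base_count R A B)
  + e1 * (chisum R A - base_chisum R A B)
  + e2 * (chisum R B - base_chisum R B A) + e1 * e2 * twisted_sum R A B.
  rewrite !level_countE /base_count /chisum /base_chisum /twisted_sum.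
  rewrite -!sumrB !mulr_sumr -!big_split /= -sum1_card natr_sum big_mkcond /= mulr_sumr.
  apply: eq_bigr => x _; rewrite inE.
  have -> : (if square_class b1 (qf A x) && square_class b2 (qf B x) then 1 else 0) =
    (square_class b1 (qf A x))%:R * (square_class b2 (qf B x))%:R :> R.
    by do 2 case: square_class; rewrite ?mulr1 ?mulr0.
  by rewrite !square_classE -/e1 -/e2; field.
have Q0 : Q != 0 by exact: card_neq0.
set r := (Q - 1) * s ^+ (n + kappa).
have EA : `|level_count R A 0 - Q ^+ n| <= r.
  by apply: excess_le => //; rewrite (leq_trans rkA) // leq_add2r.
have EB : `|level_count R B 0 - Q ^+ n| <= r.
  by apply: excess_le => //; rewrite (leq_trans rkB) // leq_add2r.
have EAB := base_count_estimate R qodd symA symB rkB rkAB.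
have XA := chisum_le R qodd symA rkA.
have XB := chisum_le R qodd symB rkB.
have YA := base_chisum_estimate R qodd symA symB rkAB rkA.
have YB := base_chisum_estimate R qodd symB symA rkBA rkB.
have T := twisted_sum_estimate R qodd symA symB rkB rkAB.
rewrite -!/r in XA XB YA YB T EAB.
have -> : 4%:R * #|D|%:R - (Q - 1) * (Q ^+ n - Q ^+ n / Q) =
  (base_count R A B - Q ^+ n / Q) - (level_count R A 0 - Q ^+ n) - (level_count R B 0 - Q ^+ n)
  + e1 * (chisum R A - base_chisum R A B)
  + e2 * (chisum R B - base_chisum R B A) + e1 * e2 * twisted_sum R A B.
  by rewrite DE QN; field.
have r0 : 0 <= r by exact: le_trans EA.
have m1 : r <= n.+2%:R * r by rewrite ler_peMl // ler1n.
rewrite !natrM -!mulrA in T *.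
have nD (x y a b : R) : `|x| <= a -> `|y| <= b -> `|x + y| <= a + b.
  by move=> xa yb; apply: (le_trans (ler_normD _ _)); apply: lerD.
have nB (x y a b : R) : `|x| <= a -> `|y| <= b -> `|x - y| <= a + b.
  by move=> xa yb; apply: nD => //; rewrite normrN.
have n1 (e x a : R) : `|e| = 1 -> `|x| <= a -> `|e * x| <= a.
  by move=> en xa; rewrite normrM en mul1r.
have n12 : `|e1 * e2| = 1 by rewrite normrM e1n e2n mulr1.
have := nD _ _ _ _ (nD _ _ _ _ (nD _ _ _ _ (nB _ _ _ _ (nB _ _ _ _ EAB EA) EB)
  (n1 _ _ _ e1n (nB _ _ _ _ XA YA))) (n1 _ _ _ e2n (nB _ _ _ _ XB YB))) (n1 _ _ _ n12 T).
rewrite -!mulrA => /le_trans; apply; lra.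
Qed.

Theorem square_count_estimate (g : 2.-tuple {mpoly F[N]}) (S : {set 'I_2}) :
  (forall x : 'rV[F]_N, (tnth g ord0).@[x ord0] = qf A x) ->
  (forall x : 'rV[F]_N, (tnth g (lift ord0 ord0)).@[x ord0] = qf B x) ->
  `|(square_count g S)%:R - (Q ^+ n - Q ^+ n / Q) / 4%:R|
     <= (73 * n.+2)%:R * s ^+ (n + kappa).
Proof.
move=> gA gB; set b1 := ord0 \in S; set b2 := lift ord0 ord0 \in S.
have := affine_count_estimate b1 b2; set D := square_cone b1 b2 => est.
have -> : square_count g S = #|[set proj_point x | x in D]%SET|.
  rewrite /square_count; apply: eq_card => P.
  apply/imsetP/imsetP => -[x xD ->]; exists x => //; move: xD; rewrite !inE.
    move=> /andP[_ /forallP H]; apply/andP; split.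
      by have := H ord0; rewrite /= gA.
    by have := H (lift ord0 ord0); rewrite /= gB.
  move=> /andP[hA hB]; apply/andP; split.
    by apply: contraNneq (square_class_neq0 hA) => ->; rewrite qf0.
  apply/forallP => i; case: (unliftP ord0 i) => [j ->|->]; rewrite /= ?gA //.
  by rewrite (ord1 j) gB.
have DE : #|D|%:R = #|[set proj_point x | x in D]%SET|%:R * (Q - 1) :> R.
  rewrite (card_cone (D := D)) => [|x|c x c0]; last 2 first.
  - by rewrite inE => /andP[/square_class_neq0 Ax _]; apply: contraNneq Ax => ->; rewrite qf0.
  - by rewrite !inE !qf_scale !square_classZ.
  by rewrite natrM -[in RHS](prednK (ltnW (finNzRing_gt1 F))) -natr1 addrK.
move: est; rewrite DE; set z := #|_|%:R => est.
have Q1 : 0 < Q - 1 by rewrite subr_gt0 card_gt1.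
rewrite -(ler_pM2l Q1) -{1}(gtr0_norm Q1) -normrM.
have -> : (Q - 1) * ((73 * n.+2)%:R * s ^+ (n + kappa)) =
  (73 * n.+2)%:R * ((Q - 1) * s ^+ (n + kappa)) by ring.
apply: le_trans est.
have -> : 4%:R * (z * (Q - 1)) - (Q - 1) * (Q ^+ n - Q ^+ n / Q) =
  4%:R * ((Q - 1) * (z - (Q ^+ n - Q ^+ n / Q) / 4%:R)).
  by field; exact: card_neq0.
by rewrite [leRHS]normrM (ger0_norm (ler0n R 4)) ler_peMl // ler1n.
Qed.

End SquareCount.

(** * Irreducibility by conics *)

Section ProjectiveGeometry.
Local Open Scope classical_set_scope.
Variables (K : closedFieldType) (n : nat).
Local Notation N := n.+1.
Implicit Types (A B C : set 'rV[K]_N) (M : 'M[K]_N) (x y : 'rV[K]_N).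

Definition has_chain A m : Prop := exists Z, irreducible_chain A m Z.

Lemma has_chain_sub A B m : A `<=` B -> has_chain A m -> has_chain B m.
Proof.
move=> AB [Z [irr incr]]; exists Z; split=> // i im.
by have [iZ ZA] := irr i im; split=> //; apply: subset_trans AB.
Qed.

(** A larger irreducible set containing a point outside A lengthens by one any
    chain of A. *)
Lemma has_chain_extend A B m x : has_chain A m -> A `<=` B -> proj_irreducible B ->
  B x -> ~ A x -> has_chain B m.+1.
Proof.
move=> [Z [irr incr]] AB irrB Bx nAx.
exists (fun i => if (i < m)%N then Z i else B); split=> i im.
  case: ifP => im'; last by split.
  by have [iZ ZA] := irr i im'; split=> //; apply: subset_trans AB.
have im' : (i < m)%N by [].
rewrite im'; case: ifP => im1; first exact: incr.
have [_ ZA] := irr i im'; split; first exact: subset_trans AB.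
by move=> BZ; apply: nAx; apply: ZA; apply: BZ.
Qed.

Lemma meval_homog_scale (p : {mpoly K[N]}) d c (v : 'I_N -> K) : p \is d.-homog ->
  p.@[fun i => c * v i] = c ^+ d * p.@[v].
Proof.
move=> /dhomogP hp; rewrite !mevalE mulr_sumr big_seq [RHS]big_seq.
apply: eq_bigr => m /hp mp; rewrite mulrCA; congr (_ * _).
rewrite -(mp : mdeg m = d) mdegE.
rewrite -prodrXr -big_split; apply: eq_bigr => i _ /=; by rewrite exprMn.
Qed.

(** A polynomial along a polynomial curve is a polynomial in the parameter, so it
    has finitely many zeros there unless it vanishes identically. *)
Lemma meval_along_curve (p : {mpoly K[N]}) (u : 'I_N -> {poly K}) :
  exists P : {poly K}, forall a, P.[a] = p.@[fun i => (u i).[a]].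
Proof.
exists (\sum_(m <- msupp p) (p@_m)%:P * \prod_i u i ^+ m i) => a.
rewrite mevalE horner_sum; apply: eq_bigr => m _.
rewrite hornerM hornerC horner_prod; congr (_ * _); apply: eq_bigr => i _.
by rewrite horner_exp.
Qed.

Definition conic (x0 x2 x1 : 'rV[K]_N) (a b : K) : 'rV[K]_N :=
  a ^+ 2 *: x0 + (a * b) *: x2 + b ^+ 2 *: x1.

(** The conic passes through x0 at infinity and through x1 at a = 0. Along it p and
    p' are polynomials in a; p is nonzero because, by homogeneity, its
    behaviour at infinity is its value at x0. *)
Lemma conic_not_in_union (p p' : {mpoly K[N]}) x0 x1 x2 :
  homogeneous_mpoly p -> homogeneous_mpoly p' -> x0 != 0 ->
  p.@[x0 ord0] != 0 -> p'.@[x1 ord0] != 0 ->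
  exists a, [/\ conic x0 x2 x1 a 1 != 0, p.@[conic x0 x2 x1 a 1 ord0] != 0 &
     p'.@[conic x0 x2 x1 a 1 ord0] != 0].
Proof.
move=> hp hp' x00 px0 px1.
have [i0 xi0] : exists i, x0 ord0 i != 0.
  apply: contrapT => H; case/eqP: x00; apply/rowP => i; rewrite mxE.
  by apply/eqP; apply: contrapT => /negP ne; apply: H; exists i.
(* Multiplying p by a coordinate that is nonzero at x0 makes the point found
   below a nonzero vector. *)
pose r := p * 'X_i0.
have [d hr] : exists d, r \is d.-homog.
  by have [d hd] := hp; exists (d + 1)%N; apply: dhomogM => //; rewrite dhomogX /= mdeg1.
have rE v : r.@[v] = p.@[v] * v i0 by rewrite mevalM mevalXU.
pose u i : {poly K} := (x0 ord0 i)%:P * 'X^2 + (x2 ord0 i)%:P * 'X + (x1 ord0 i)%:P.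
pose u' i : {poly K} := (x0 ord0 i)%:P + (x2 ord0 i)%:P * 'X + (x1 ord0 i)%:P * 'X^2.
have uE a : (fun i => (u i).[a]) =1 (conic x0 x2 x1 a 1) ord0.
  by move=> i; rewrite /u !hornerE !mxE /=; ring.
have u'E b : (fun i => (u' i).[b]) =1 (conic x0 x2 x1 1 b) ord0.
  by move=> i; rewrite /u' !hornerE !mxE /=; ring.
have [P PE] := meval_along_curve r u; have [P2 P2E] := meval_along_curve r u'.
have [P' P'E] := meval_along_curve p' u.
have nz2 : P2 != 0.
  apply: contraNneq (mulf_neq0 px0 xi0) => P20.
  rewrite -rE; have := P2E 0; rewrite P20 horner0 => ->; apply/eqP; apply: meval_eq => i.
  by rewrite u'E !mxE; ring.
have nz' : P' != 0.
  apply: contraNneq px1 => P20.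
  have := P'E 0; rewrite P20 horner0 => ->; apply/eqP; apply: meval_eq => i.
  by rewrite uE !mxE; ring.
have nz : P != 0.
  have /closed_nonrootP[b] : P2 * 'X != 0 by rewrite mulf_neq0 ?polyX_eq0.
  rewrite rootE hornerM hornerX mulf_eq0 => /norP[Pb b0].
  apply: contraNneq Pb => P0; have := PE b^-1; rewrite P0 horner0 => r0.
  rewrite P2E (_ : meval _ r = b ^+ (2 * d) * r.@[fun i => (u i).[b^-1]]); last first.
    rewrite exprM -meval_homog_scale //; apply: meval_eq => i.
    by rewrite u'E uE !mxE; field.
  by rewrite -r0 mulr0.
have /closed_nonrootP[a] : P * P' != 0 by rewrite mulf_neq0.
rewrite rootE hornerM PE P'E rE !mulf_eq0 => /norP[/norP[] h1 h2] h3.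
exists a; split.
- by apply: contraNneq h2 => c0; rewrite uE c0 mxE.
- by rewrite -(meval_eq _ (uE a)).
- by rewrite -(meval_eq _ (uE a)).
Qed.

(** If A is a union of two proper closed subsets, some x0 and x1 in A each lie outside
    one of them; a conic in A through both points contains a point outside both. *)
Lemma irreducible_of_conics A : proj_closed A -> A !=set0 ->
  (forall x0 x1, A x0 -> A x1 -> exists c x2, c != 0 /\
     forall a b, conic x0 x2 (c *: x1) a b != 0 -> A (conic x0 x2 (c *: x1) a b)) ->
  proj_irreducible A.
Proof.
move=> clA neA joinA; split=> // B C [GB hB BE] [GC hC CE] ABC.
apply: contrapT => /not_orP[AB AC].
have nz x : A x -> x != 0 by have [GA _ ->] := clA; case.
have witness D G : D = zero_locus G -> D `<=` A -> A <> D ->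
    exists x p, [/\ A x, G p & p.@[x ord0] != 0].
  move=> DE DA AD; apply: contrapT => H; apply: AD; rewrite eqEsubset; split=> // x Ax.
  rewrite DE; split; first exact: nz.
  move=> p Gp; apply/eqP; apply: contrapT => /negP px; apply: H.
  by exists x, p.
have [x0 [p [Ax0 Gp px0]]] : exists x p, [/\ A x, GB p & p.@[x ord0] != 0].
  by apply: witness BE _ AB; rewrite ABC; apply: subsetUl.
have [x1 [p' [Ax1 Gp' px1]]] : exists x p, [/\ A x, GC p & p.@[x ord0] != 0].
  by apply: witness CE _ AC; rewrite ABC; apply: subsetUr.
have [c [x2 [c0 join]]] := joinA _ _ Ax0 Ax1.
have pcx1 : p'.@[(c *: x1) ord0] != 0.
  have [d hd] := hC p' Gp'.
  rewrite (meval_eq _ (v2 := fun i => c * x1 ord0 i)); last by move=> i; rewrite mxE.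
  by rewrite (meval_homog_scale _ _ hd) mulf_neq0 // expf_neq0.
have [a [y0 py p'y]] := conic_not_in_union x2 (hB p Gp) (hC p' Gp') (nz _ Ax0) px0 pcx1.
have := join a 1 y0; rewrite ABC BE CE => -[[_ /(_ p Gp)]|[_ /(_ p' Gp')]] /eqP.
  by rewrite (negbTE py).
by rewrite (negbTE p'y).
Qed.

End ProjectiveGeometry.

(** * Chains of quadrics *)

Section QuadricPolynomial.
Variables (K : fieldType) (n : nat).
Local Notation N := n.+1.

Definition linear_mpoly (L : 'cV[K]_N) : {mpoly K[N]} := \sum_i L i 0 *: 'X_i.
Definition quadratic_mpoly (M : 'M[K]_N) : {mpoly K[N]} :=
  \sum_i \sum_j M i j *: ('X_i * 'X_j).

Lemma linear_mpoly_homog L : linear_mpoly L \is 1.-homog.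
Proof. by apply: rpred_sum => i _; apply: rpredZ; rewrite dhomogX /= mdeg1. Qed.

Lemma quadratic_mpoly_homog M : quadratic_mpoly M \is 2.-homog.
Proof.
apply: rpred_sum => i _; apply: rpred_sum => j _; apply: rpredZ.
by rewrite -mpolyXD dhomogX /= mdegD !mdeg1.
Qed.

Lemma meval_linear_mpoly L (x : 'rV[K]_N) : (linear_mpoly L).@[x ord0] = (x *m L) 0 0.
Proof.
by rewrite mxE raddf_sum; apply: eq_bigr => i _; rewrite /= mevalZ mevalXU mulrC.
Qed.

Lemma meval_quadratic_mpoly M (x : 'rV[K]_N) : (quadratic_mpoly M).@[x ord0] = qf M x.
Proof.
rewrite /bf mxE raddf_sum.
transitivity (\sum_i \sum_j x 0 i * M i j * x 0 j).
  apply: eq_bigr => i _; rewrite /= raddf_sum; apply: eq_bigr => j _ /=.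
  by rewrite mevalZ mevalM !mevalXU; ring.
rewrite exchange_big /=; apply: eq_bigr => j _; rewrite !mxE mulr_suml.
by apply: eq_bigr.
Qed.

Lemma mderiv_quadratic_mpoly M (x : 'rV[K]_N) k :
  ((quadratic_mpoly M)^`M(k)).@[x ord0] = (x *m (M + M^T)) 0 k.
Proof.
have dX1 (i : 'I_N) : ('X_i : {mpoly K[N]})^`M(k) = (i == k)%:R.
  rewrite mderivX mnm1E; case: eqVneq => [->|_]; last by rewrite scale0r.
  rewrite scale1r (_ : (U_(k) - U_(k))%MM = 0%MM) ?mpolyX0 //.
  by apply/mnmP => l; rewrite mnmBE subnn mnm0E.
have dX (i j : 'I_N) : (('X_i * 'X_j : {mpoly K[N]})^`M(k)).@[x ord0] =
    (i == k)%:R * x 0 j + x 0 i * (j == k)%:R.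
  by rewrite mderivM !dX1 mevalD !mevalM !mevalXU !rmorph_nat.
rewrite /quadratic_mpoly (raddf_sum (mderiv k)) raddf_sum mulmxDr mxE.
transitivity (\sum_i \sum_j (M i j * ((i == k)%:R * x 0 j) + M i j * (x 0 i * (j == k)%:R))).
  apply: eq_bigr => i _; rewrite (raddf_sum (mderiv k)) raddf_sum; apply: eq_bigr => j _.
  by rewrite /= mderivZ mevalZ dX mulrDr.
under eq_bigr do rewrite big_split.
rewrite big_split addrC; congr (_ + _).
  rewrite (bigD1 k) //= [X in _ + X]big1 => [|i /negbTE->].
    by rewrite addr0 mxE; apply: eq_bigr => j _; rewrite eqxx mul1r mxE mulrC.
  by rewrite big1 // => j _; rewrite mul0r mulr0.
rewrite mxE; apply: eq_bigr => i _; rewrite (bigD1 k) //= eqxx mulr1 big1 ?addr0.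
  exact: mulrC.
by move=> j /negbTE->; rewrite !mulr0.
Qed.

(** The matrix need not be symmetric: monomials are collected one by one, so that no
    coefficient has to be halved. *)
Lemma homog2_quadratic (f : {mpoly K[N]}) : f \is 2.-homog ->
  exists M, f = quadratic_mpoly M.
Proof.
move=> /dhomogP hf; rewrite [f]mpolyE big_seq; apply: (big_ind (fun p => exists M, p = quadratic_mpoly M)).
- by exists 0; rewrite /quadratic_mpoly big1 // => i _; rewrite big1 // => j _; rewrite mxE scale0r.
- move=> _ _ [M1 ->] [M2 ->]; exists (M1 + M2); rewrite /quadratic_mpoly -big_split.
  apply: eq_bigr => i _; rewrite -big_split; apply: eq_bigr => j _.
  by rewrite mxE scalerDl.
move=> m /hf mm.
have [i [j ->]] : exists i j, m = (U_(i) + U_(j))%MM.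
  have [i mi] : exists i, m i != 0%N.
    case: (pickP (fun i => m i != 0%N)) => [i mi|H]; first by exists i.
    move: (mm : mdeg m = 2%N); rewrite mdegE big1 // => i _.
    exact/eqP/negbFE/H.
  have le : (U_(i) <= m)%MM by rewrite lep1mP.
  have : mdeg (m - U_(i))%MM == 1%N.
    have := congr1 mdeg (submK le); rewrite mdegD mdeg1 (mm : mdeg m = 2%N) addn1.
    by move=> [->].
  rewrite mdeg_eq1 => /existsP[j /eqP E]; exists i, j.
  by rewrite -E addmC submK.
exists (f@_(U_(i) + U_(j)) *: delta_mx i j).
rewrite /quadratic_mpoly (bigD1 i) //= [X in _ + X]big1 => [|i' ni]; last first.
  by rewrite big1 // => j' _; rewrite !mxE (negbTE ni) mulr0 scale0r.
rewrite addr0 (bigD1 j) //= big1 => [|j' nj]; last first.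
  by rewrite !mxE (negbTE nj) andbF mulr0 scale0r.
by rewrite addr0 !mxE !eqxx mulr1 mpolyXD.
Qed.

End QuadricPolynomial.

Section QuadricChains.
Local Open Scope classical_set_scope.
Variables (K : closedFieldType) (n : nat).
Local Notation N := n.+1.
Hypothesis two0 : 2%:R != 0 :> K.
Implicit Types (W M : 'M[K]_N) (x y : 'rV[K]_N).

(** The quadric M in the projective space of W; for M = 0 it is that whole space. *)
Definition quadric_in W M : set 'rV[K]_N :=
  [set x | [/\ x != 0, (x <= W)%MS & qf M x = 0]].

Lemma quadric_closed W M : proj_closed (quadric_in W M).
Proof.
exists [set p | p = quadratic_mpoly M \/ exists j, p = linear_mpoly (col j (cokermx W))].
  move=> p [->|[j ->]]; [exists 2%N | exists 1%N].
    exact: quadratic_mpoly_homog.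
  exact: linear_mpoly_homog.
rewrite eqEsubset; split=> x.
  move=> [x0 xW qx]; split=> // p [->|[j ->]].
    by rewrite meval_quadratic_mpoly.
  rewrite meval_linear_mpoly colE mulmxA; move: xW; rewrite submxE => /eqP->.
  by rewrite mul0mx mxE.
move=> [x0 H]; split=> //.
  rewrite submxE; apply/eqP/rowP => j.
  have := H _ (or_intror (ex_intro _ j erefl)).
  by rewrite meval_linear_mpoly colE mulmxA -colE mxE => ->; rewrite mxE.
by rewrite -meval_quadratic_mpoly; apply: H; left.
Qed.

(** The form takes the value (a b)^2 (2 c bf x0 x1 + qf x2) on the conic. *)
Lemma conic_in_quadric W M x0 x1 x2 c a b : M^T = M ->
  (x0 <= W)%MS -> (x1 <= W)%MS -> (x2 <= W)%MS ->
  qf M x0 = 0 -> qf M x1 = 0 -> bf M x0 x2 = 0 -> bf M x1 x2 = 0 ->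
  2%:R * c * bf M x0 x1 + qf M x2 = 0 ->
  conic x0 x2 (c *: x1) a b != 0 -> quadric_in W M (conic x0 x2 (c *: x1) a b).
Proof.
move=> symM W0 W1 W2 q0 q1 b02 b12 q2 nz; split=> //.
  by rewrite !addmx_sub ?scalemx_sub.
rewrite /conic !(bfDl, bfDr, bfZl, bfZr) q0 q1 b02 b12.
rewrite [bf M x2 x0]bf_sym // [bf M x2 x1]bf_sym // [bf M x1 x0]bf_sym // b02 b12.
transitivity ((a * b) ^+ 2 * (2%:R * c * bf M x0 x1 + qf M x2)); first by ring.
by rewrite q2 mulr0.
Qed.

(** Orthogonal points of the quadric are joined by a line in it. Two points that are
    not orthogonal are joined by a conic through a suitable multiple of any
    anisotropic vector orthogonal to both. If there is no such vector, the
    hyperplane of W orthogonal to x0 is totally isotropic. *)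
Lemma isotropic_hyperplane_or_irreducible W M : M^T = M -> quadric_in W M !=set0 ->
  proj_irreducible (quadric_in W M) \/
  exists U : 'M[K]_N, [/\ (U <= W)%MS, (\rank W <= (\rank U).+1)%N &
    forall x, (x <= U)%MS -> qf M x = 0].
Proof.
move=> symM ne.
case: (pselect (exists x0 x1, [/\ quadric_in W M x0, quadric_in W M x1, bf M x0 x1 != 0 &
   forall x2, (x2 <= W)%MS -> bf M x0 x2 = 0 -> bf M x1 x2 = 0 -> qf M x2 = 0])).
  move=> [x0 [x1 [[x00 W0 q0] [x10 W1 q1] h H]]]; right.
  pose U : 'M[K]_N := (W :&: kermx (M *m x0^T))%MS; exists U; split.
  - exact: capmxSl.
  - by rewrite -(mxrank_mul_ker W (M *m x0^T)) addnC -[(\rank U).+1]addn1 leq_add2l rank_leq_col.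
  - move=> x; rewrite sub_capmx => /andP[xW]; rewrite sub_kermx => /eqP x0M.
    have b0x : bf M x0 x = 0 by rewrite bf_sym // /bf -mulmxA x0M mxE.
    pose a := bf M x1 x / bf M x0 x1.
    have bya : qf M (x - a *: x0) = 0.
      apply: H.
      - by rewrite addmx_sub // -scaleNr scalemx_sub.
      - by rewrite -scaleNr bfDr bfZr q0 b0x mulr0 addr0.
      - by rewrite -scaleNr bfDr bfZr [bf M x1 x0]bf_sym // /a; field.
    have b0y : bf M x0 (x - a *: x0) = 0 by rewrite -scaleNr bfDr bfZr q0 b0x mulr0 addr0.
    rewrite -(subrK (a *: x0) x); move: (x - _) bya b0y => y bya b0y.
    by rewrite bfDl !bfDr !bfZl !bfZr bya q0 [bf M y x0]bf_sym // b0y; ring.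
move=> H; left; apply: irreducible_of_conics => //; first exact: quadric_closed.
move=> x0 x1 Ax0 Ax1; have [x00 W0 q0] := Ax0; have [x10 W1 q1] := Ax1.
have [h|h] := eqVneq (bf M x0 x1) 0.
  exists 1, (x0 + x1); split=> [|a b]; first exact: oner_neq0.
  rewrite scale1r; have -> : conic x0 (x0 + x1) x1 a b = (a + b) *: (a *: x0 + b *: x1).
    by apply/rowP => i; rewrite !mxE; ring.
  move=> nz; split=> //; first by rewrite scalemx_sub // addmx_sub ?scalemx_sub.
  by rewrite !(bfZl, bfZr, bfDl, bfDr) q0 q1 [bf M x1 x0]bf_sym // h; ring.
have [x2 [W2 b0 b1 q2]] : exists x2, [/\ (x2 <= W)%MS, bf M x0 x2 = 0, bf M x1 x2 = 0 &
    qf M x2 != 0].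
  apply: contrapT => H2; apply: H; exists x0, x1; split=> // x2 W2 b0 b1.
  by apply/eqP; apply: contrapT => /negP q2; apply: H2; exists x2.
exists (- qf M x2 / (2%:R * bf M x0 x1)), x2; split.
  by rewrite mulf_neq0 ?oppr_eq0 ?invr_eq0 ?mulf_neq0.
move=> a b; apply: conic_in_quadric => //.
by field; rewrite h.
Qed.

(** A hyperplane of W that misses x, to be used as the next smaller ambient space of
    a chain. *)
Lemma split_off_vector W x : (x <= W)%MS -> x != 0 ->
  exists U : 'M[K]_N, [/\ (U <= W)%MS, \rank W = (\rank U).+1 & ~~ (x <= U)%MS].
Proof.
move=> xW x0; exists (W :\: x)%MS; split; first exact: diffmxSl.
  rewrite -(mxrank_cap_compl W x) -[RHS]add1n; congr (_ + _)%N.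
  by rewrite (capmx_idPr xW) rank_rV x0.
apply: contraNN x0 => xU; have : (x <= (W :\: x) :&: x)%MS by rewrite sub_capmx xU submx_refl.
by rewrite capmx_diff submx0.
Qed.

Lemma nonzero_vector_in W : (0 < \rank W)%N -> exists2 x : 'rV[K]_N, (x <= W)%MS & x != 0.
Proof.
by rewrite lt0n mxrank_eq0 => /rowV0Pn.
Qed.

(** On a line u + t v the form is a quadratic polynomial in t, which has a root over a
    closed field. *)
Lemma isotropic_vector W M : (1 < \rank W)%N -> quadric_in W M !=set0.
Proof.
move=> rW; have [v vW v0] := nonzero_vector_in (ltnW rW).
have [U [UW rU vU]] := split_off_vector vW v0.
have [|u uU u0] := @nonzero_vector_in U; first by move: rW; rewrite rU.
have [qv|qv] := eqVneq (qf M v) 0; first by exists v.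
have [t rt] : exists t, qf M (u + t *: v) = 0.
  pose P : {poly K} := (qf M u)%:P + (bf M u v + bf M v u)%:P * 'X + (qf M v)%:P * 'X^2.
  have /closed_rootP[t] : size P != 1%N.
    rewrite /P addrC size_polyDl; first by rewrite size_mulXn ?polyC_eq0 // size_polyC qv.
    rewrite size_mulXn ?polyC_eq0 // size_polyC qv.
    rewrite (leq_ltn_trans (size_polyD _ _)) // gtn_max ltnS (leq_trans (size_polyC_leq1 _)) //=.
    rewrite (leq_ltn_trans (size_polyMleq _ _)) // size_polyX addn2 /= ltnS.
    by rewrite ltnS size_polyC_leq1.
  rewrite rootE /P !hornerE => /eqP rt; exists t.
  by rewrite bfDl !bfDr !bfZl !bfZr -[RHS]rt /=; ring.
exists (u + t *: v); split=> //; last by rewrite addmx_sub ?scalemx_sub // (submx_trans uU).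
have [t0|t0] := eqVneq t 0; first by rewrite t0 scale0r addr0.
apply: contraNneq vU => uv; have -> : v = - t^-1 *: u.
  have -> : u = - (t *: v) by apply/eqP; rewrite -addr_eq0 uv.
  by rewrite scalerN scaleNr opprK scalerA mulVf // scale1r.
exact: scalemx_sub.
Qed.

Lemma quadric_in_sub U W M M' : (U <= W)%MS ->
  (forall x, (x <= U)%MS -> qf M x = 0 -> qf M' x = 0) ->
  quadric_in U M `<=` quadric_in W M'.
Proof.
by move=> UW qq x [x0 xU qx]; split=> //; [exact: submx_trans UW | exact: qq].
Qed.

Lemma bf_zero x y : bf (0 : 'M[K]_N) x y = 0.
Proof. by rewrite /bf mulmx0 mul0mx mxE. Qed.

(** A full flag of linear subspaces. *)
Lemma linear_chain d W : (d <= \rank W)%N -> has_chain (quadric_in W 0) d.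
Proof.
elim: d W => [|d IH] W dW; first by exists (fun=> set0); split.
have [x xW x0] := nonzero_vector_in (leq_trans (ltn0Sn d) dW).
have [U [UW rU xU]] := split_off_vector xW x0.
have Wx : quadric_in W 0 x by split=> //; rewrite bf_zero.
apply: (@has_chain_extend _ _ (quadric_in U 0) _ _ x) => //.
- by apply: IH; rewrite -ltnS -rU.
- exact: quadric_in_sub.
- apply: irreducible_of_conics; [exact: quadric_closed | by exists x |].
  move=> x0' x1 [_ W0 _] [_ W1 _]; exists 1, 0; split=> [|a b]; first exact: oner_neq0.
  by move=> nz; apply: conic_in_quadric; rewrite ?sub0mx ?bf_zero ?trmx0 ?mulr0 ?addr0.
- by case=> _ H; rewrite H in xU.
Qed.

(** Either the quadric is irreducible and lengthens the chain of a hyperplane section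
    that misses one of its points, or it contains a linear space of the same
    dimension. *)
Lemma quadric_chain d W M : M^T = M -> (d < \rank W)%N -> has_chain (quadric_in W M) d.
Proof.
move=> symM; elim: d W => [|d IH] W dW; first by exists (fun=> set0); split.
have ne : quadric_in W M !=set0 by apply: isotropic_vector; apply: leq_trans dW.
case: (isotropic_hyperplane_or_irreducible symM ne) => [irr|[U [UW rU iso]]].
  have [x Wx] := ne; have [x0 xW _] := Wx.
  have [U [UW rU xU]] := split_off_vector xW x0.
  apply: (@has_chain_extend _ _ (quadric_in U M) _ _ x) => //.
  - by apply: IH; rewrite -ltnS -rU.
  - exact: quadric_in_sub.
  - by case=> _ H; rewrite H in xU.
apply: (@has_chain_sub _ _ (quadric_in U 0)).
  by apply: quadric_in_sub => // x xU _; apply: iso.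
by apply: linear_chain; rewrite -ltnS (leq_trans dW).
Qed.

End QuadricChains.

(** * Singular loci, and the passage to another field *)

Section SingularLoci.
Local Open Scope classical_set_scope.
Variables (K : closedFieldType) (n : nat).
Local Notation N := n.+1.
Hypothesis two0 : 2%:R != 0 :> K.
Implicit Types (c : 'M[K]_N) (x : 'rV[K]_N) (s : int).

Lemma tr_symmetrized (F : fieldType) m (c : 'M[F]_m) : (c + c^T)^T = c + c^T.
Proof. by rewrite linearD /= trmxK addrC. Qed.

(** c + c^T is the Hessian matrix of the form x c x^T. *)
Lemma qf_symmetrized (F : fieldType) m (c : 'M[F]_m) (x : 'rV[F]_m) :
  qf (c + c^T) x = 2%:R * qf c x.
Proof.
have -> : qf (c + c^T) x = qf c x + qf c^T x by rewrite /bf mulmxDr mulmxDl mxE.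
have -> : qf c^T x = qf c x; last by rewrite mulr_natl.
transitivity ((x *m c *m x^T)^T 0 0); last by rewrite mxE.
by rewrite /bf !trmx_mul trmxK mulmxA.
Qed.

Lemma qf_symmetrized_eq0 c x : qf (c + c^T) x = 0 -> qf c x = 0.
Proof. by rewrite qf_symmetrized => /eqP; rewrite mulf_eq0 (negbTE two0) => /eqP. Qed.

Lemma kernel_qf (M : 'M[K]_N) x : (x <= kermx M)%MS -> qf M x = 0.
Proof. by move/sub_kermxP; rewrite /bf => ->; rewrite mul0mx mxE. Qed.

Lemma rank_le_of_chain (A : set 'rV[K]_N) s m :
  is_proj_dim A s -> has_chain A m -> m%:Z <= s + 1.
Proof. by move=> [_ H] [Z /H]; rewrite lerBlDr. Qed.

(** The gradient of the form at x is x (c + c^T), so the singular points are exactly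
    the nonzero vectors of the kernel of the Hessian. *)
Lemma sing_locus_quadric c s :
  is_proj_dim (sing_locus [tuple quadratic_mpoly c]) s ->
  N%:Z <= s + 1 + (\rank (c + c^T)%R)%:Z.
Proof.
set H := c + c^T => hs.
have chain : has_chain (quadric_in (kermx H) 0) (\rank (kermx H)) by exact: linear_chain.
have := rank_le_of_chain hs (has_chain_sub _ chain).
rewrite mxrank_ker => le.
have {}le : (N - \rank H)%:Z <= s + 1.
  apply: le => x [x0 xH _]; split; first split=> // p.
    rewrite /= inE => /eqP->; rewrite meval_quadratic_mpoly.
    exact/qf_symmetrized_eq0/kernel_qf.
  have -> : jacobian [tuple quadratic_mpoly c] x = 0.
    apply/matrixP => i j; rewrite !mxE (tnth_nth 0) (ord1 i) /= mderiv_quadratic_mpoly.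
    by move/sub_kermxP: xH => ->; rewrite mxE.
  by rewrite mxrank0.
by have := rank_leq_row H; lia.
Qed.

(** A linear relation between the two gradients makes the rows of the Jacobian
    dependent. *)
Lemma sing_locus_pair c1 c2 x a b : x != 0 -> (a != 0) || (b != 0) ->
  qf (c1 + c1^T) x = 0 -> qf (c2 + c2^T) x = 0 ->
  x *m (a *: (c1 + c1^T) + b *: (c2 + c2^T)) = 0 ->
  sing_locus [tuple quadratic_mpoly c1; quadratic_mpoly c2] x.
Proof.
move=> x0 ab q1 q2 xab; split.
  split=> // p; rewrite /= !inE => /orP[] /eqP->; rewrite meval_quadratic_mpoly;
  exact: qf_symmetrized_eq0.
set J := jacobian _ _; rewrite ltn_neqAle rank_leq_row andbT.
apply/negP => fr; have /row_free_inj inj : row_free J by [].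
pose v : 'rV[K]_2 := \row_i (if i == ord0 then a else b).
have J0 j : J ord0 j = (x *m (c1 + c1^T)) 0 j.
  by rewrite mxE (tnth_nth 0) /= mderiv_quadratic_mpoly.
have J1 j : J (lift ord0 ord0) j = (x *m (c2 + c2^T)) 0 j.
  by rewrite mxE (tnth_nth 0) /= mderiv_quadratic_mpoly.
have v0 : v = 0.
  apply: inj; rewrite mul0mx -xab mulmxDr -!scalemxAr; apply/rowP => j.
  rewrite mxE !big_ord_recl big_ord0 addr0 J0 J1 [RHS]mxE ![(_ *: (x *m _)) _ _]mxE.
  by congr (_ * _ + _ * _); rewrite mxE.
by move: ab; have := congr1 (fun w : 'rV_2 => (w 0 ord0, w 0 (lift ord0 ord0))) v0;
  rewrite !mxE /= => -[-> ->]; rewrite eqxx.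
Qed.

(** On the kernel of H1 - t H2, the forms H1 and t H2 agree, so the zeros there of H2
    are common zeros; they form a quadric, of dimension at least
    corank - 2. *)
Lemma sing_locus_pencil c1 c2 s t :
  is_proj_dim (sing_locus [tuple quadratic_mpoly c1; quadratic_mpoly c2]) s ->
  N%:Z <= s + 2 + (\rank ((c1 + c1^T) - t *: (c2 + c2^T))%R)%:Z /\
  N%:Z <= s + 2 + (\rank ((c2 + c2^T) - t *: (c1 + c1^T))%R)%:Z.
Proof.
set H1 := c1 + c1^T; set H2 := c2 + c2^T => hs.
have s1 : 0 <= s + 1.
  by apply: (rank_le_of_chain (m := 0) hs); exists (fun=> set0); split.
have gen (D M : 'M[K]_N) : M^T = M ->
   quadric_in (kermx D) M `<=` sing_locus [tuple quadratic_mpoly c1; quadratic_mpoly c2] ->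
   N%:Z <= s + 2 + (\rank D)%:Z.
  move=> symM sub; have rD := rank_leq_row D; have rk := mxrank_ker D.
  case E : (\rank (kermx D)) rk => [|d] rk; first by lia.
  have ch : has_chain (quadric_in (kermx D) M) d by apply: quadric_chain => //; rewrite E.
  by have := rank_le_of_chain hs (has_chain_sub sub ch); lia.
split.
  apply: (gen _ H2); first exact: tr_symmetrized.
  move=> x [x0 /sub_kermxP xD q2].
  apply: (@sing_locus_pair _ _ _ 1 (- t)); rewrite ?oner_neq0 //; last first.
    by rewrite scale1r scaleNr.
  have -> : c1 + c1^T = (H1 - t *: H2) + t *: H2 by rewrite subrK.
  by rewrite /bf mulmxDr xD add0r -scalemxAr -scalemxAl mxE -[X in _ * X]/(qf H2 x) q2 mulr0.
apply: (gen _ H1); first exact: tr_symmetrized.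
move=> x [x0 /sub_kermxP xD q1].
apply: (@sing_locus_pair _ _ _ (- t) 1); rewrite ?oner_neq0 ?orbT //; last first.
  by rewrite scale1r scaleNr addrC.
have -> : c2 + c2^T = (H2 - t *: H1) + t *: H1 by rewrite subrK.
by rewrite /bf mulmxDr xD add0r -scalemxAr -scalemxAl mxE -[X in _ * X]/(qf H1 x) q1 mulr0.
Qed.

End SingularLoci.

Section Transfer.
Variables (k Fq : finFieldType) (K : closedFieldType).
Variables (j : {rmorphism k -> Fq}) (iota : {rmorphism k -> K}).

(** t' is a root in K of the minimal polynomial of t over k. *)
Lemma transfer_root (t : Fq) : exists t' : K, forall D : {poly k},
  (map_poly j D).[t] = 0 -> (map_poly iota D).[t'] = 0.
Proof.
pose vanish (D : {poly k}) := (map_poly j D).[t] = 0.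
have [d [[p [p0 vp dp]] mind]] : exists d,
   (exists p, [/\ p != 0, vanish p & size p = d]) /\
   forall p, p != 0 -> vanish p -> (d <= size p)%N.
  have ex : exists d, `[< exists p, [/\ p != 0, vanish p & size p = d] >].
    exists (size ('X^#|Fq| - 'X : {poly k})); apply/asboolP.
    exists ('X^#|Fq| - 'X); split=> //.
      by rewrite -lead_coef_eq0 lead_coefDl ?size_polyXn ?size_polyN ?size_polyX
        ?ltnS ?finNzRing_gt1 // lead_coefXn oner_neq0.
    by rewrite /vanish rmorphB /= map_polyXn map_polyX !hornerE expf_card subrr.
  case: (ex_minnP ex) => d /asboolP hd mind; exists d; split=> // p p0 vp.
  by apply: mind; apply/asboolP; exists p.
have /closed_rootP[t' rt'] : size (map_poly iota p) != 1%N.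
  rewrite size_map_poly; apply/negP => /size_poly1P[c c0 pc].
  move: vp; rewrite /vanish pc map_polyC hornerC => /eqP.
  by rewrite fmorph_eq0 (negbTE c0).
exists t' => D vD.
have : p %| D.
  apply/eqP; apply: contrapT => /eqP r0.
  have vr : vanish (D %% p).
    have := vD; rewrite {1}(divp_eq D p) rmorphD rmorphM hornerD hornerM.
    by rewrite (vp : (map_poly j p).[t] = 0) mulr0 add0r.
  by have := mind (D %% p) r0 vr; rewrite -dp leqNgt ltn_modp p0.
move=> /divpK <-; rewrite rmorphM hornerM; move/rootP: rt' => ->; exact: mulr0.
Qed.

Lemma map_pencil_minor (L : fieldType) (i : {rmorphism k -> L}) N r
    (f : 'I_r -> 'I_N) (A B : 'M[k]_N) :
  map_poly i (pencil_minor f A B) = pencil_minor f (map_mx i A) (map_mx i B).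
Proof.
rewrite /pencil_minor -det_map_mx; congr (\det _); apply/matrixP => a b.
by rewrite !mxE /= rmorphB rmorphM /= !map_polyC map_polyX.
Qed.

(** A principal minor that is nonzero over K at t' is the value of a polynomial over
    k, which therefore does not vanish at t either. *)
Lemma rank_transfer N (A B : 'M[k]_N) (t : Fq) : A^T = A -> B^T = B ->
  exists t' : K, (\rank (map_mx iota A - t' *: map_mx iota B)%R <=
                  \rank (map_mx j A - t *: map_mx j B)%R)%N.
Proof.
move=> symA symB; have [t' Ht'] := transfer_root t; exists t'.
set MK := map_mx iota A - _.
have symK : MK^T = MK by rewrite /MK linearB linearZ /= !map_trmx symA symB.
have [f u] := exists_principal_minor symK.
apply: (@minor_rank _ _ _ f f); move: u; rewrite !unitmxE !unitfE.
rewrite -!horner_pencil_minor -!map_pencil_minor.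
by apply: contra => /eqP D0; apply/eqP; exact: Ht'.
Qed.

End Transfer.

Lemma odd_card_of_pchar (k Fq : finFieldType) (j : {rmorphism k -> Fq}) :
  2%N \notin [pchar k] -> odd #|Fq|.
Proof.
move=> ch; have [p pp pF] := finPcharP Fq.
have [e cF] : exists e, #|Fq| = (p ^ e)%N by eexists; exact: card_pprimeChar pF.
rewrite cF oddX; case: (even_prime pp) => [p2|->]; last by rewrite orbT.
case/negP: ch; rewrite inE /= -(fmorph_eq0 j) rmorph_nat -p2.
by move: pF; rewrite inE => /andP[].
Qed.

Theorem theorem7 (R : realType) (n : nat) :
  exists C : R,
  forall (k : finFieldType) (hchar : 2%N \notin [pchar k])
    (f1 f2 : {mpoly k[n.+1]})
    (hom1 : f1 \is 2.-homog) (hom2 : f2 \is 2.-homog)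
    (irr1 : irreducible_mpoly f1) (irr2 : irreducible_mpoly f2)
    (nonassoc : ~ exists2 c : k, c != 0 & f1 = c *: f2)
    (kbar : closedFieldType) (iota : {rmorphism k -> kbar})
    (hkbar : is_algebraic_closure iota)
    (s1 s2 s12 sigma : int)
    (hs1 : is_proj_dim (sing_locus [tuple map_mpoly iota f1]) s1)
    (hs2 : is_proj_dim (sing_locus [tuple map_mpoly iota f2]) s2)
    (hs12 : is_proj_dim
              (sing_locus [tuple map_mpoly iota f1; map_mpoly iota f2]) s12)
    (hsigma : sigma = Num.max s1 (Num.max s2 s12))
    (Fq : finFieldType) (j : {rmorphism k -> Fq}) (S : {set 'I_2}),
  let q : R := #|Fq|%:R in
  let N : R :=
    (square_count [tuple map_mpoly j f1; map_mpoly j f2] S)%:R in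
  `|N - (q ^ n%:Z - q ^ (n%:Z - 1)) / 4%:R|
    <= C * Num.sqrt q ^ (n%:Z + sigma + 1).
Proof.
exists (73 * n.+2)%:R => k hchar f1 f2 hom1 hom2 _ _ _ K iota _ s1 s2 s12 sigma.
move=> hs1 hs2 hs12 hsigma Fq j S; cbv zeta.
have qodd := odd_card_of_pchar j hchar.
have two_k : 2%:R != 0 :> k.
  by apply: contraNneq hchar => two0; rewrite inE /= two0 eqxx.
have two_K : 2%:R != 0 :> K by rewrite -(rmorph_nat iota) fmorph_eq0.
have two_q : 2%:R != 0 :> Fq by rewrite -(rmorph_nat j) fmorph_eq0.
have [c1 f1E] := homog2_quadratic hom1; have [c2 f2E] := homog2_quadratic hom2.
have mapE (L : fieldType) (i : {rmorphism k -> L}) c :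
    map_mpoly i (quadratic_mpoly c) = quadratic_mpoly (map_mx i c) :> {mpoly L[n.+1]}.
  rewrite /quadratic_mpoly raddf_sum; apply: eq_bigr => a _.
  rewrite /= raddf_sum; apply: eq_bigr => b _ /=.
  by rewrite map_mpolyZ rmorphM /= !map_mpolyX mxE.
rewrite {}f1E {}f2E !mapE in hs1 hs2 hs12 *.
pose H1 := c1 + c1^T; pose H2 := c2 + c2^T.
have symH1 : H1^T = H1 by exact: tr_symmetrized.
have symH2 : H2^T = H2 by exact: tr_symmetrized.
have mapH (L : fieldType) (i : {rmorphism k -> L}) (c : 'M[k]_n.+1) :
    map_mx i c + (map_mx i c)^T = map_mx i (c + c^T).
  by rewrite map_mxD map_trmx.
have b1 := sing_locus_quadric two_K hs1; have b2 := sing_locus_quadric two_K hs2.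
have b12 t := sing_locus_pencil two_K t hs12.
rewrite !mapH !mxrank_map -/H1 -/H2 in b1 b2.
have {}b12 t : (n.+1%:Z <= s12 + 2 + (\rank (map_mx j H1 - t *: map_mx j H2)%R)%:Z) /\
               (n.+1%:Z <= s12 + 2 + (\rank (map_mx j H2 - t *: map_mx j H1)%R)%:Z).
  split.
    have [t' le] := rank_transfer j iota t symH1 symH2.
    by have H := (b12 t').1; rewrite !mapH in H; apply: (le_trans H); rewrite lerD2l lez_nat.
  have [t' le] := rank_transfer j iota t symH2 symH1.
  by have H := (b12 t').2; rewrite !mapH in H; apply: (le_trans H); rewrite lerD2l lez_nat.
have sig1 : s1 <= sigma by rewrite hsigma le_max lexx.
have sig2 : s2 <= sigma by rewrite hsigma !le_max lexx orbT.
have sig12 : s12 <= sigma by rewrite hsigma !le_max lexx !orbT.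
have sig0 : 0 <= sigma + 1.
  have : 0 <= s1 + 1 by apply: (rank_le_of_chain (m := 0) hs1); exists (fun=> set0); split.
  lia.
have [kappa kE] : exists kappa : nat, sigma + 1 = kappa%:Z.
  by exists (absz (sigma + 1)); rewrite gez0_abs.
(* H1 and H2 represent the doubles of the two forms. *)
pose A := 2%:R^-1 *: map_mx j H1; pose B := 2%:R^-1 *: map_mx j H2.
have half0 : (2%:R : Fq)^-1 != 0 by rewrite invr_eq0.
have diffE (X Y : 'M[Fq]_n.+1) t : 2%:R^-1 *: X - t *: (2%:R^-1 *: Y) = 2%:R^-1 *: (X - t *: Y).
  by rewrite scalerBr !scalerA [t * _]mulrC.
have le12 : s12 + 2 <= kappa.+1%:Z by lia.
have symA : A^T = A by rewrite /A linearZ /= map_trmx symH1.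
have symB : B^T = B by rewrite /B linearZ /= map_trmx symH2.
have rkA : (n.+1 <= kappa + \rank A)%N by rewrite mxrank_scale_nz // mxrank_map; lia.
have rkB : (n.+1 <= kappa + \rank B)%N by rewrite mxrank_scale_nz // mxrank_map; lia.
have rkAB t : (n.+1 <= kappa.+1 + \rank (A - t *: B)%R)%N.
  rewrite diffE mxrank_scale_nz // -lez_nat PoszD.
  by apply: (le_trans (b12 t).1); rewrite lerD2r.
have rkBA t : (n.+1 <= kappa.+1 + \rank (B - t *: A)%R)%N.
  rewrite diffE mxrank_scale_nz // -lez_nat PoszD.
  by apply: (le_trans (b12 t).2); rewrite lerD2r.
have qfE (c : 'M[k]_n.+1) (x : 'rV[Fq]_n.+1) :
    qf (map_mx j c) x = qf (2%:R^-1 *: map_mx j (c + c^T)) x.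
  by rewrite bfZ -mapH qf_symmetrized mulKf.
have := @square_count_estimate R Fq qodd n kappa A B symA symB rkA rkB rkAB rkBA
  [tuple quadratic_mpoly (map_mx j c1); quadratic_mpoly (map_mx j c2)] S.
have -> : n%:Z + sigma + 1 = (n + kappa)%:Z by rewrite PoszD -kE addrA.
have Q0 : #|Fq|%:R != 0 :> R by exact: card_neq0.
rewrite (expfzDr _ _ Q0) exprN1; apply.
  by move=> x; rewrite (tnth_nth 0) /= meval_quadratic_mpoly qfE.
by move=> x; rewrite (tnth_nth 0) /= meval_quadratic_mpoly qfE.
Qed.
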